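(* Let $\mathcal{R}=\{L_i\xleftarrow{f_i}K_i\xrightarrow{g_i}R_i\}_{i\in\mathcal{I}}$ be a left-connected rewriting system over a signature $\Sigma$, and consider the procedure (Algorithm 3) described below. (Correctness) Every cospan $L_i+L_j\xrightarrow{\epsilon_{ij\gamma};\epsilon_{ij\gamma'}}S_{ij\gamma'}\xleftarrow{[\subseteq,\subseteq]}in(S_{ij\gamma'})+out(S_{ij\gamma'})$ output by the procedure determines a critical pair, i.e. $\iota_1;\epsilon_{ij\gamma};\epsilon_{ij\gamma'}$ and $\iota_2;\epsilon_{ij\gamma};\epsilon_{ij\gamma'}$ are mono, $\epsilon_{ij\gamma};\epsilon_{ij\gamma'}$ is epi, $in(S_{ij\gamma'})\xrightarrow{\subseteq}S_{ij\gamma'}\xleftarrow{\subseteq}out(S_{ij\gamma'})$ is an ma-cospan, and the two derivations from this ma-cospan with these matches via the $i$-th and $j$-th rules form a critical pair. (Exhaustiveness) Conversely, for every $i,j\in\mathcal{I}$ and every critical pair given by a cospan $L_i+L_j\twoheadrightarrow X\xleftarrow{[\subseteq,\subseteq]}in(X)+out(X)$, the procedure yields this cospan (up to isomorphism of $X$ compatible with the maps from $L_i+L_j$ and the interfaces).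
   Context: A signature $\Sigma$ is a set of triples $(x,n,m)$ (label, arity, coarity). A $\Sigma$-hypergraph $G=(V,E,s,t,l)$ has finite sets $V$ (nodes), $E$ (hyperedges), maps $s,t\colon E\to V^*$ (lists of sources/targets) and a labelling $l\colon E\to\Sigma$ sending a hyperedge with $n$ sources and $m$ targets to some $(x,n,m)$. Morphisms preserve sources, targets and labels; they form the category $\mathbf{Hyp}_\Sigma$, where colimits (coproducts $+$, coequalisers $\mathtt{coeq}$) are computed componentwise and monos/epis are injective/surjective on nodes and hyperedges. Composition is written $f;g$; $\iota_1,\iota_2$ are coprojections. A hypergraph is discrete if it has no hyperedges. A path is a list of hyperedges $[e_1,\dots,e_n]$ with some target of $e_k$ equal to a source of $e_{k+1}$ for each $k$; it goes from $v$ to $v'$ if $v$ is a source of $e_1$ and $v'$ a target of $e_n$; a cycle is a path with some source of $e_1$ a target of $e_n$. In-degree (out-degree) of a node $v$: number of pairs $(e,i)$ with $v$ the $i$-th target (source) of $e$; $in(H)$, $out(H)$: nodes of in-degree $0$, out-degree $0$. $H$ is ma (monogamous acyclic) if it has no cycle and all in- and out-degrees are $\le 1$. A cospan $I\to H\leftarrow O$ with $I,O$ discrete is an ma-cospan if $H$ is ma and the legs are mono with images $in(H)$ and $out(H)$. $H$ is strongly connected if for all $x\in in(H)$, $y\in out(H)$ there is a path from $x$ to $y$. A left-connected rule is a span $L\xleftarrow{[i_L,o_L]}K=I+O\xrightarrow{[i_R,o_R]}R$ with $I,O$ discrete, $I\to L\leftarrow O$ and $I\to R\leftarrow O$ ma-cospans,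 $[i_L,o_L]$ mono and $L$ strongly connected; a left-connected rewriting system is a finite set of such rules. A convex match is a mono $m\colon L\to G$ such that every path in $G$ between two nodes of $m(L)$ has all its hyperedges in $m(L)$. A derivation between ma-cospans $n\to G\leftarrow m$ and $n\to H\leftarrow m$ via a rule $L\leftarrow K\to R$ is given by a convex match $L\to G$, a hypergraph $C$ and a diagram $G\leftarrow C\to H$, $K\to C$, $R\to H$, $n+m\to C$ in which $K,L,C,G$ and $K,R,C,H$ are pushout squares (the left one a boundary complement, automatic for left-connected systems) and everything commutes with the interfaces; for left-connected systems mono matches are automatically convex and pushout complements exist uniquely, so a derivation from a given ma-cospan is determined by the rule and a mono match. A pre-critical pair consists of two derivations, via rules $L_1\leftarrow K_1\to R_1$ and $L_2\leftarrow K_2\to R_2$ with pushout complements $C_1,C_2$, from a common ma-cospan $n\to S\leftarrow m$ with matches $m_1,m_2$ such that $[m_1,m_2]\colon L_1+L_2\to S$ is epi; it is parallel if there exist $g_1\colon L_1\to C_2$, $g_2\colon L_2\to C_1$ with $g_1$ followed by $C_2\to S$ equal to $m_1$ and $g_2$ followed by $C_1\to S$ equal to $m_2$; it is critical if not parallel. For left-connected systems a pre-critical pair is thus determined by a cospan $L_1+L_2\twoheadrightarrow S\leftarrow n+m$ whose left leg is epi with mono restrictions to $L_1$ and $L_2$ and with $n\to S\leftarrow m$ an ma-cospan. An independent edge set on the complete bipartite graph $K_{A,B}$ (vertices $A+B$, an edge between each element of $A$ and each element of $B$) is a set of its edges no two sharing a vertex. The procedure (Algorithm 3): for every ordered pair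 $(i,j)\in\mathcal{I}^2$, and for every set $M$ of pairs $(e,e')$ with $e$ a hyperedge of $L_i$, $e'$ a hyperedge of $L_j$ and $l(e)=l(e')$, such that $M$ is an independent edge set (no hyperedge occurs in two pairs), do: let $\gamma$ be the induced hypergraph of $M$, whose hyperedges are the pairs $(e,e')\in M$ and whose nodes are the pairs $(v,v')$ such that for some $(e,e')\in M$ and some $k$, $v$ and $v'$ are the $k$-th sources (or the $k$-th targets) of $e$ and $e'$ respectively, the sources/targets of $(e,e')$ being the componentwise pairs, with projections $p_1^\gamma\colon\gamma\to L_i$, $p_2^\gamma\colon\gamma\to L_j$. If $\gamma$ has at least one hyperedge: let $\epsilon_{ij\gamma}\colon L_i+L_j\to S_{ij\gamma}$ be the coequaliser of $p_1^\gamma;\iota_1$ and $p_2^\gamma;\iota_2$; set $I_1=in(S_{ij\gamma})\cap\epsilon_{ij\gamma}(\iota_1(in(L_i)))$, $I_2=in(S_{ij\gamma})\cap\epsilon_{ij\gamma}(\iota_2(in(L_j)))$, $O_1=out(S_{ij\gamma})\cap\epsilon_{ij\gamma}(\iota_1(out(L_i)))$, $O_2=out(S_{ij\gamma})\cap\epsilon_{ij\gamma}(\iota_2(out(L_j)))$. For every $N$ that is either an independent edge set on $K_{I_1,O_2}$ or an independent edge set on $K_{I_2,O_1}$, let $\gamma'$ be the discrete hypergraph with nodes the pairs in $N$ and projections $p_1^{\gamma'},p_2^{\gamma'}\colon\gamma'\to S_{ij\gamma}$, and let $\epsilon_{ij\gamma'}\colon S_{ij\gamma}\to S_{ij\gamma'}$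 be their coequaliser. If $in(S_{ij\gamma'})\xrightarrow{\subseteq}S_{ij\gamma'}\xleftarrow{\subseteq}out(S_{ij\gamma'})$ is an ma-cospan, output $L_i+L_j\xrightarrow{\epsilon_{ij\gamma};\epsilon_{ij\gamma'}}S_{ij\gamma'}\xleftarrow{[\subseteq,\subseteq]}in(S_{ij\gamma'})+out(S_{ij\gamma'})$. *)

(* Defs.v *)
From mathcomp Require Import all_boot.
Set Implicit Arguments. Unset Strict Implicit. Unset Printing Implicit Defensive.

(* A signature: a type of symbols, each carrying an arity and a coarity
   (an element of the signature is thus a triple (x, n, m)). *)
Record signature := Signature {
  sym : Type; sym_ar : sym -> nat; sym_coar : sym -> nat }.

Section Hyp.
Variable Sg : signature.

(* raw hypergraph; the arity constraint is the predicate [wf] below *)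
Record hyp := Hyp {
  hV : finType; hE : finType;
  hsrc : hE -> seq hV; htgt : hE -> seq hV; hlab : hE -> sym Sg }.

Definition wf (G : hyp) : Prop :=
  forall e : hE G, size (hsrc e) = sym_ar (hlab e) /\ size (htgt e) = sym_coar (hlab e).

Record hom (G H : hyp) := Hom { hmV : hV G -> hV H; hmE : hE G -> hE H }.

Definition is_hom (G H : hyp) (f : hom G H) : Prop :=
  forall e : hE G, hsrc (hmE f e) = map (hmV f) (hsrc e) /\
            htgt (hmE f e) = map (hmV f) (htgt e) /\
            hlab (hmE f e) = hlab e.

Definition hcomp (A B C : hyp) (f : hom A B) (g : hom B C) : hom A C :=
  Hom (fun v => hmV g (hmV f v)) (fun e => hmE g (hmE f e)).

Definition homeq (A B : hyp) (f g : hom A B) : Prop :=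
  hmV f =1 hmV g /\ hmE f =1 hmE g.

Definition mono (A B : hyp) (f : hom A B) : Prop :=
  injective (hmV f) /\ injective (hmE f).
Definition epi (A B : hyp) (f : hom A B) : Prop :=
  (forall y, exists x, hmV f x = y) /\ (forall y, exists x, hmE f x = y).
Definition iso (A B : hyp) (f : hom A B) : Prop :=
  is_hom f /\ bijective (hmV f) /\ bijective (hmE f).

Definition hsum (G H : hyp) : hyp :=
  @Hyp (hV G + hV H)%type (hE G + hE H)%type
    (fun e => match e with inl a => map inl (hsrc a) | inr b => map inr (hsrc b) end)
    (fun e => match e with inl a => map inl (htgt a) | inr b => map inr (htgt b) end)
    (fun e => match e with inl a => hlab a | inr b => hlab b end).

Definition inj1 (G H : hyp) : hom G (hsum G H) :=
  @Hom G (hsum G H) (fun v => inl v) (fun e => inl e).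
Definition inj2 (G H : hyp) : hom H (hsum G H) :=
  @Hom H (hsum G H) (fun v => inr v) (fun e => inr e).

Definition copair (G H K : hyp) (f : hom G K) (g : hom H K) : hom (hsum G H) K :=
  @Hom (hsum G H) K
    (fun v => match v with inl a => hmV f a | inr b => hmV g b end)
    (fun e => match e with inl a => hmE f a | inr b => hmE g b end).

Definition is_discrete (G : hyp) : Prop := #|hE G| = 0.

Definition void_elim (T : Type) (x : void) : T := match x with end.

Definition discrete_hyp (T : finType) : hyp :=
  @Hyp T void (void_elim _) (void_elim _) (void_elim _).

Definition indeg (G : hyp) (v : hV G) : nat := \sum_(e : hE G) count_mem v (htgt e).
Definition outdeg (G : hyp) (v : hV G) : nat := \sum_(e : hE G) count_mem v (hsrc e).
Definition inP (G : hyp) : pred (hV G) := fun v => indeg v == 0.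
Definition outP (G : hyp) : pred (hV G) := fun v => outdeg v == 0.

Definition hin (G : hyp) : hyp := discrete_hyp {v : hV G | inP v}.
Definition hout (G : hyp) : hyp := discrete_hyp {v : hV G | outP v}.
Definition hin_incl (G : hyp) : hom (hin G) G :=
  @Hom (hin G) G (fun v => val v) (void_elim _).
Definition hout_incl (G : hyp) : hom (hout G) G :=
  @Hom (hout G) G (fun v => val v) (void_elim _).

Definition adj (G : hyp) (e e' : hE G) : bool := has (fun v => v \in hsrc e') (htgt e).

Definition path_from_to (G : hyp) (v v' : hV G) (l : seq (hE G)) : Prop :=
  match l with
  | [::] => False
  | e :: p => path (@adj G) e p /\ v \in hsrc e /\ v' \in htgt (last e p)
  end.

Definition is_cycle (G : hyp) (l : seq (hE G)) : Prop :=
  match l with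
  | [::] => False
  | e :: p => path (@adj G) e p /\ adj (last e p) e
  end.

Definition ma (G : hyp) : Prop :=
  (forall l : seq (hE G), ~ is_cycle l) /\ (forall v : hV G, indeg v <= 1 /\ outdeg v <= 1).

Definition ma_cospan (I O H : hyp) (fi : hom I H) (fo : hom O H) : Prop :=
  is_discrete I /\ is_discrete O /\ wf H /\ ma H /\
  is_hom fi /\ is_hom fo /\ mono fi /\ mono fo /\
  (forall v, inP v <-> exists x, hmV fi x = v) /\
  (forall v, outP v <-> exists x, hmV fo x = v).

Definition strongly_connected (G : hyp) : Prop :=
  forall x y : hV G, inP x -> outP y -> exists l : seq (hE G), path_from_to x y l.

Definition convex (L G : hyp) (m : hom L G) : Prop :=
  forall (x y : hV L) (l : seq (hE G)), path_from_to (hmV m x) (hmV m y) l ->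
    forall e, e \in l -> exists e0, hmE m e0 = e.

Definition is_pushout (A B C D : hyp) (a : hom A B) (b : hom A C)
    (c : hom B D) (d : hom C D) : Prop :=
  wf D /\ is_hom c /\ is_hom d /\ homeq (hcomp a c) (hcomp b d) /\
  forall (T : hyp) (x : hom B T) (y : hom C T), wf T -> is_hom x -> is_hom y ->
    homeq (hcomp a x) (hcomp b y) ->
    (exists u : hom D T, is_hom u /\ homeq (hcomp c u) x /\ homeq (hcomp d u) y) /\
    (forall u u' : hom D T, is_hom u -> is_hom u' ->
       homeq (hcomp c u) x -> homeq (hcomp d u) y ->
       homeq (hcomp c u') x -> homeq (hcomp d u') y -> homeq u u').

Definition is_coeq (A B Q : hyp) (f g : hom A B) (q : hom B Q) : Prop :=
  wf Q /\ is_hom q /\ homeq (hcomp f q) (hcomp g q) /\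
  forall (T : hyp) (x : hom B T), wf T -> is_hom x -> homeq (hcomp f x) (hcomp g x) ->
    (exists u : hom Q T, is_hom u /\ homeq (hcomp q u) x) /\
    (forall u u' : hom Q T, is_hom u -> is_hom u' ->
       homeq (hcomp q u) x -> homeq (hcomp q u') x -> homeq u u').

Record rule := Rule {
  rI : hyp; rO : hyp; rL : hyp; rR : hyp;
  riL : hom rI rL; roL : hom rO rL; riR : hom rI rR; roR : hom rO rR }.

Definition rK (r : rule) : hyp := hsum (rI r) (rO r).
Definition rf (r : rule) : hom (rK r) (rL r) := copair (riL r) (roL r).
Definition rg (r : rule) : hom (rK r) (rR r) := copair (riR r) (roR r).

Definition left_connected_rule (r : rule) : Prop :=
  is_discrete (rI r) /\ is_discrete (rO r) /\
  ma_cospan (riL r) (roL r) /\ ma_cospan (riR r) (roR r) /\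
  mono (rf r) /\ strongly_connected (rL r).

Record deriv (r : rule) (n m G : hyp) (nG : hom n G) (mG : hom m G) := Deriv {
  dH : hyp; dnH : hom n dH; dmH : hom m dH;
  dmatch : hom (rL r) G;
  dC : hyp; dCG : hom dC G; dCH : hom dC dH;
  dKC : hom (rK r) dC; dRH : hom (rR r) dH;
  dnmC : hom (hsum n m) dC }.

Definition is_deriv (r : rule) n m G (nG : hom n G) (mG : hom m G)
    (d : @deriv r n m G nG mG) : Prop :=
  ma_cospan nG mG /\ ma_cospan (dnH d) (dmH d) /\
  wf (dC d) /\
  is_hom (dmatch d) /\ mono (dmatch d) /\ convex (dmatch d) /\
  is_hom (dKC d) /\ is_hom (dnmC d) /\
  is_pushout (rf r) (dKC d) (dmatch d) (dCG d) /\
  is_pushout (rg r) (dKC d) (dRH d) (dCH d) /\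
  homeq (hcomp (dnmC d) (dCG d)) (copair nG mG) /\
  homeq (hcomp (dnmC d) (dCH d)) (copair (dnH d) (dmH d)).

Definition pre_critical (r1 r2 : rule) n m S (nS : hom n S) (mS : hom m S)
    (d1 : @deriv r1 n m S nS mS) (d2 : @deriv r2 n m S nS mS) : Prop :=
  is_deriv d1 /\ is_deriv d2 /\ epi (copair (dmatch d1) (dmatch d2)).

Definition parallel (r1 r2 : rule) n m S (nS : hom n S) (mS : hom m S)
    (d1 : @deriv r1 n m S nS mS) (d2 : @deriv r2 n m S nS mS) : Prop :=
  exists (g1 : hom (rL r1) (dC d2)) (g2 : hom (rL r2) (dC d1)),
    is_hom g1 /\ is_hom g2 /\
    homeq (hcomp g1 (dCG d2)) (dmatch d1) /\ homeq (hcomp g2 (dCG d1)) (dmatch d2).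

Definition critical (r1 r2 : rule) n m S (nS : hom n S) (mS : hom m S)
    (d1 : @deriv r1 n m S nS mS) (d2 : @deriv r2 n m S nS mS) : Prop :=
  pre_critical d1 d2 /\ ~ parallel d1 d2.

Section Alg.
Variables L1 L2 : hyp.
Variable M : {set hE L1 * hE L2}.

Definition gnode (p : hV L1 * hV L2) : bool :=
  [exists x in M, (p \in zip (hsrc x.1) (hsrc x.2)) || (p \in zip (htgt x.1) (htgt x.2))].

Definition gammaV : finType := {p : hV L1 * hV L2 | gnode p}.
Definition gammaE : finType := {x : hE L1 * hE L2 | x \in M}.

Definition gamma : hyp :=
  @Hyp gammaV gammaE
    (fun x => pmap insub (zip (hsrc (val x).1) (hsrc (val x).2)))
    (fun x => pmap insub (zip (htgt (val x).1) (htgt (val x).2)))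
    (fun x => hlab (val x).1).

Definition gamma_p1 : hom gamma L1 :=
  @Hom gamma L1 (fun p : gammaV => (val p).1) (fun x : gammaE => (val x).1).
Definition gamma_p2 : hom gamma L2 :=
  @Hom gamma L2 (fun p : gammaV => (val p).2) (fun x : gammaE => (val x).2).
End Alg.

Definition edge_matching (L1 L2 : hyp) (M : {set hE L1 * hE L2}) : Prop :=
  (forall x, x \in M -> hlab x.1 = hlab x.2) /\
  (forall x y, x \in M -> y \in M -> x != y -> x.1 != y.1 /\ x.2 != y.2).

Definition indep_bip (T : finType) (A B : pred T) (N : {set T * T}) : Prop :=
  (forall x, x \in N -> A x.1 /\ B x.2) /\
  (forall x y, x \in N -> y \in N -> x != y -> x.1 != y.1 /\ x.2 != y.2).

Definition dproj1 (S : hyp) (T : finType) (N : {set T * T}) (h : T -> hV S)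
  : hom (discrete_hyp {x : T * T | x \in N}) S :=
  @Hom (discrete_hyp {x : T * T | x \in N}) S (fun x => h (val x).1) (void_elim _).
Definition dproj2 (S : hyp) (T : finType) (N : {set T * T}) (h : T -> hV S)
  : hom (discrete_hyp {x : T * T | x \in N}) S :=
  @Hom (discrete_hyp {x : T * T | x \in N}) S (fun x => h (val x).2) (void_elim _).

(* [alg_output Li Lj S' q]: the procedure, run on the pair of rules with
   left-hand sides Li, Lj (for some choice of coequalisers), outputs the cospan
   Li + Lj -q-> S' <-[incl,incl]- in(S') + out(S'),  q = eps_gamma ; eps_gamma'. *)
Definition alg_output (Li Lj S' : hyp) (q : hom (hsum Li Lj) S') : Prop :=
  exists M : {set hE Li * hE Lj},
    edge_matching M /\ M != set0 /\
    exists (S : hyp) (eps : hom (hsum Li Lj) S),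
      is_coeq (hcomp (gamma_p1 M) (inj1 Li Lj)) (hcomp (gamma_p2 M) (inj2 Li Lj)) eps /\
      let I1 := fun v : hV S => inP v && [exists u : hV Li, inP u && (hmV eps (inl u) == v)] in
      let I2 := fun v : hV S => inP v && [exists u : hV Lj, inP u && (hmV eps (inr u) == v)] in
      let O1 := fun v : hV S => outP v && [exists u : hV Li, outP u && (hmV eps (inl u) == v)] in
      let O2 := fun v : hV S => outP v && [exists u : hV Lj, outP u && (hmV eps (inr u) == v)] in
      exists N : {set hV S * hV S},
        (indep_bip I1 O2 N \/ indep_bip I2 O1 N) /\
        exists eps' : hom S S',
          is_coeq (dproj1 N id) (dproj2 N id) eps' /\
          ma_cospan (hin_incl S') (hout_incl S') /\
          homeq q (hcomp eps eps').

End Hyp.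

(* Main.v *)
Require Import Defs.
From mathcomp Require Import all_boot.

Set Implicit Arguments. Unset Strict Implicit. Unset Printing Implicit Defensive.

(* A map from a strongly connected L to a monogamous acyclic S that is injective
   on hyperedges is mono: two identified nodes would both have an incoming or
   both an outgoing hyperedge, contradicting monogamy, or be an input and an
   output of L, contradicting acyclicity. Such a map is convex for the same
   reason, and replacing L by R creates no cycle because no path outside the
   match leads from an output of L to an input of L. A pair is parallel exactly
   when the two matches share no hyperedge: a shared hyperedge cannot lie in a
   pushout complement, and a shared node that is interior to one match is
   incident to a shared hyperedge. For exhaustiveness take M to be the pairs of
   hyperedges with the same image in X. The nodes that the quotient by M still
   has to identify are an input of one left-hand side and an output of the
   other, always in the same direction by acyclicity; they form N. *)

Section Hypergraphs.
Variable Sg : signature.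
Implicit Types A B C D G H L Q T : hyp Sg.

(** * Incidences and degrees *)

(* [true] selects sources and [false] selects targets, so that dual arguments
   are carried out once. *)
Definition inc b G (e : hE G) : seq (hV G) := if b then hsrc e else htgt e.

Definition deg b G (v : hV G) : nat := \sum_(e : hE G) count_mem v (inc b e).

Definition bdry b G (v : hV G) : bool := deg b v == 0.

Lemma inc_hom b G H (f : hom G H) e : is_hom f ->
  inc b (hmE f e) = map (hmV f) (inc b e).
Proof. by move=> /(_ e)[h1 [h2 _]]; case: b. Qed.

Lemma lab_hom G H (f : hom G H) e : is_hom f -> hlab (hmE f e) = hlab e.
Proof. by move=> /(_ e)[_ []]. Qed.

Lemma is_hom_inc G H (f : hom G H) :
  (forall b e, inc b (hmE f e) = map (hmV f) (inc b e)) ->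
  (forall e, hlab (hmE f e) = hlab e) -> is_hom f.
Proof. by move=> fi fl e; split; [exact: (fi true) | split; [exact: (fi false)|]]. Qed.

Lemma is_hom_eq G H (f g : hom G H) : homeq f g -> is_hom f -> is_hom g.
Proof.
move=> [fgV fgE] hf; apply: is_hom_inc => [b e|e].
  by rewrite -fgE inc_hom //; apply: eq_map.
by rewrite -fgE lab_hom.
Qed.

Lemma mono_eq G H (f g : hom G H) : homeq f g -> mono f -> mono g.
Proof.
by move=> [fgV fgE] [fV fE]; split=> x y; rewrite -?fgV -?fgE; [apply: fV|apply: fE].
Qed.

Lemma is_hom_comp A B C (f : hom A B) (g : hom B C) :
  is_hom f -> is_hom g -> is_hom (hcomp f g).
Proof.
move=> hf hg; apply: is_hom_inc => [b e|e] /=.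
  by rewrite !inc_hom // -map_comp.
by rewrite !lab_hom.
Qed.

Lemma is_hom_copair A B C (f : hom A C) (g : hom B C) :
  is_hom f -> is_hom g -> is_hom (copair f g).
Proof.
move=> hf hg; apply: is_hom_inc => [b [e|e]|[e|e]] /=; rewrite ?lab_hom //.
  by rewrite inc_hom //; case: b; rewrite -map_comp.
by rewrite inc_hom //; case: b; rewrite -map_comp.
Qed.

Lemma is_hom_inj1 A B : is_hom (inj1 A B). Proof. by []. Qed.
Lemma is_hom_inj2 A B : is_hom (inj2 A B). Proof. by []. Qed.

Lemma wf_hsum A B : wf A -> wf B -> wf (hsum A B).
Proof. by move=> wA wB [e|e]; rewrite /= !size_map. Qed.

Definition ar b (s : sym Sg) := if b then sym_ar s else sym_coar s.

Lemma wf_inc G b (e : hE G) : wf G -> size (inc b e) = ar b (hlab e).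
Proof. by move=> /(_ e)[]; case: b. Qed.

Lemma inc_wf G : (forall b (e : hE G), size (inc b e) = ar b (hlab e)) -> wf G.
Proof. by move=> h e; split; [exact: (h true)|exact: (h false)]. Qed.

Lemma onth_inc_hom b G H (f : hom G H) e k v : is_hom f ->
  onth (inc b e) k = Some v -> onth (inc b (hmE f e)) k = Some (hmV f v).
Proof. by move=> hf ek; rewrite inc_hom // onth_map ek. Qed.

Lemma onth_hom_inv b G H (f : hom G H) e k w : is_hom f ->
  onth (inc b (hmE f e)) k = Some w -> exists2 v, onth (inc b e) k = Some v & hmV f v = w.
Proof.
by move=> hf; rewrite inc_hom // onth_map; case: onth => //= v [<-]; exists v.
Qed.

Lemma mem_inc_hom b G H (f : hom G H) e v : is_hom f ->
  v \in inc b e -> hmV f v \in inc b (hmE f e).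
Proof. by move=> hf ev; rewrite inc_hom // map_f. Qed.

Lemma mem_hom_inv b G H (f : hom G H) e w : is_hom f ->
  w \in inc b (hmE f e) -> exists2 v, v \in inc b e & hmV f v = w.
Proof. by move=> hf; rewrite inc_hom // => /mapP[v ve ->]; exists v. Qed.

Lemma bdryP b G (v : hV G) : reflect (forall e, v \notin inc b e) (bdry b v).
Proof.
rewrite /bdry /deg sum_nat_eq0; apply: (iffP forallP) => h e.
  by apply/count_memPn/eqP; have := h e; rewrite implyTb.
by apply/implyP=> _; apply/eqP/count_memPn.
Qed.

Lemma bdryPn b G (v : hV G) :
  reflect (exists e k, onth (inc b e) k = Some v) (~~ bdry b v).
Proof.
apply: (iffP idP) => [nb|[e [k ek]]]; last first.
  by apply/bdryP => /(_ e)/negP; apply; apply/onthP; exists k.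
have /existsP[e /onthP[k ek]] : [exists e, v \in inc b e]; last by exists e, k.
by apply: contraR nb => /existsPn h; apply/bdryP.
Qed.

Lemma count_mem_le1P (T : eqType) (v : T) s :
  reflect (forall k k', onth s k = Some v -> onth s k' = Some v -> k = k')
          (count_mem v s <= 1).
Proof.
elim: s => [|x s ih] /=; first by left=> k k'; rewrite onth0n.
case: (eqVneq x v) => [->|xv] /=; last first.
  have nx : Some x <> Some v by case=> e; rewrite e eqxx in xv.
  rewrite add0n; apply: (iffP ih) => h k k'; last by move=> h1 h2; have [] := h k.+1 k'.+1 h1 h2.
  by case: k k' => [|k] [|k'] //= hk hk'; congr S; apply: h.
rewrite add1n ltnS leqn0; apply: (iffP eqP) => [/count_memPn/onthPn h|h].
  by move=> [|k] [|k'] //= => [_|+ _|+ _] => /eqP; rewrite (negPf (h _)).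
by apply/count_memPn/onthPn => k; apply/eqP => hk; have := h 0 k.+1 erefl hk.
Qed.

(* Degree at most one, phrased so that it transports along homomorphisms. *)
Lemma deg_le1P b G (v : hV G) :
  deg b v <= 1 <->
  (forall e k e' k', onth (inc b e) k = Some v -> onth (inc b e') k' = Some v ->
     e = e' /\ k = k').
Proof.
split=> [d1 e k e' k' ek ek'|h].
  case: (eqVneq e e') => [ee|ne].
    split=> //; subst e'; move: k k' ek ek'; apply/count_mem_le1P.
    by apply: leq_trans d1; rewrite /deg (bigD1 e) //= leq_addr.
  exfalso; move: d1; rewrite /deg (bigD1 e) //= (bigD1 e') /=; last by rewrite eq_sym.
  have c1: 0 < count_mem v (inc b e) by rewrite -has_count has_pred1; apply/onthP; exists k.
  have c2: 0 < count_mem v (inc b e') by rewrite -has_count has_pred1; apply/onthP; exists k'.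
  by rewrite leqNgt => /negP; apply; rewrite addnA; apply: ltn_addr; apply: (leq_add c1 c2).
case: (boolP (bdry b v)) => [/eqP->//|/bdryPn[e [k ek]]].
rewrite /deg (bigD1 e) //= big1 ?addn0 => [|e' ne].
  by apply/count_mem_le1P => i j hi hj; have [] := h _ _ _ _ hi hj.
by apply/count_memPn/onthPn => k'; apply/eqP => hk'; have [ee] := h _ _ _ _ hk' ek; rewrite ee eqxx in ne.
Qed.

Lemma deg_le1_mem b G (v : hV G) e e' : deg b v <= 1 ->
  v \in inc b e -> v \in inc b e' -> e = e'.
Proof. by move=> /deg_le1P h /onthP[k hk] /onthP[k' hk']; have [] := h _ _ _ _ hk hk'. Qed.

Lemma ma_deg b G (v : hV G) : ma G -> deg b v <= 1.
Proof. by move=> [_ /(_ v)[]]; case: b. Qed.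

(** * Acyclicity *)

Lemma adjP G (e e' : hE G) :
  reflect (exists2 v, v \in inc false e & v \in inc true e') (adj e e').
Proof. exact: hasP. Qed.

Lemma adj_hom G H (f : hom G H) e e' : is_hom f -> adj e e' -> adj (hmE f e) (hmE f e').
Proof.
move=> hf /adjP[v ve ve']; apply/adjP.
by exists (hmV f v); apply: mem_inc_hom.
Qed.

Lemma connect_hom G H (f : hom G H) e e' : is_hom f ->
  connect (@adj _ G) e e' -> connect (@adj _ H) (hmE f e) (hmE f e').
Proof.
move=> hf /connectP[p pp ->]; apply/connectP; exists (map (hmE f) p); last by rewrite last_map.
by elim: p e pp => //= e1 p ih e /andP[a pp]; rewrite adj_hom //= ih.
Qed.

Lemma acyclicP G :
  (forall l : seq (hE G), ~ is_cycle l) <->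
  (forall e e', connect (@adj _ G) e e' -> ~ adj e' e).
Proof.
split=> [nc e e' /connectP[p pp ->] a|nc [|e p] //= [pp a]].
  by apply: (nc (e :: p)).
by apply: (nc e (last e p)) a; apply/connectP; exists p.
Qed.

(** The rank counts the hyperedges from which [e] is reachable. Along an adjacency this set grows
    strictly, since [e'] reaches itself but, by acyclicity, not [e]. *)
Lemma acyclic_rank G : (forall l : seq (hE G), ~ is_cycle l) ->
  exists rk : hE G -> nat, (forall e, rk e <= #|hE G|) /\
    forall e e', adj e e' -> rk e < rk e'.
Proof.
move=> /acyclicP nc; exists (fun e => #|[pred f | connect (@adj _ G) f e]|).
split=> [e|e e' a]; first exact: max_card.
apply: proper_card; apply/properP; split.
  by apply/subsetP=> f; rewrite !inE => fe; apply: connect_trans fe (connect1 a).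
exists e'; rewrite inE ?connect0 //.
by apply/negP => c; apply: nc c a.
Qed.

Lemma rank_acyclic G (rk : hE G -> nat) :
  (forall e e', adj e e' -> rk e < rk e') -> forall l : seq (hE G), ~ is_cycle l.
Proof.
move=> h; apply/acyclicP => e e' /connectP[p pp ->] /h.
suff: rk e <= rk (last e p) by rewrite leqNgt => /negP.
by elim: p e pp => //= e1 p ih e /andP[/h a /ih b]; apply: leq_trans (ltnW a) b.
Qed.

Lemma path_from_toP G (v v' : hV G) :
  (exists l, path_from_to v v' l) <->
  (exists e e', [/\ connect (@adj _ G) e e', v \in inc true e & v' \in inc false e']).
Proof.
split=> [[[|e p]] // [pp [ve ve']]|[e [_ [/connectP[p pp ->] ve ve']]]].
  by exists e, (last e p); split=> //; apply/connectP; exists p.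
by exists (e :: p).
Qed.

(** * Universal constructions *)

(* One node, hyperedges [F]: a test object that only sees hyperedges. *)
Definition bouquet (F : finType) (lab : F -> sym Sg) : hyp Sg :=
  @Hyp Sg unit F (fun e => nseq (sym_ar (lab e)) tt)
    (fun e => nseq (sym_coar (lab e)) tt) lab.

Lemma wf_bouquet F lab : wf (@bouquet F lab).
Proof. by move=> e; rewrite /= !size_nseq. Qed.

Definition to_bouquet G (F : finType) (lab : F -> sym Sg) (f : hE G -> F) : hom G (bouquet lab) :=
  @Hom Sg G (bouquet lab) (fun _ => tt) f.

(** With a single node, incidence lists carry only their lengths, and these are fixed by the
    label. *)
Lemma is_hom_to_bouquet G F lab f : wf G -> (forall e, lab (f e) = hlab e) ->
  is_hom (@to_bouquet G F lab f).
Proof.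
move=> wG fl; apply: is_hom_inc => [b e|e] //=.
have -> : inc b (f e : hE (bouquet lab)) = nseq (ar b (hlab e)) tt.
  by rewrite -fl; case: b.
by rewrite -(wf_inc b e wG); elim: (inc b e) => //= x s <-.
Qed.

Lemma factor_hom B Q T (q : hom B Q) (x : hom B T) :
  is_hom q -> epi q -> is_hom x ->
  (forall v v', hmV q v = hmV q v' -> hmV x v = hmV x v') ->
  (forall e e', hmE q e = hmE q e' -> hmE x e = hmE x e') ->
  exists u : hom Q T, is_hom u /\ homeq (hcomp q u) x.
Proof.
move=> hq [qV qE] hx kV kE.
have /fin_all_exists[uV uVP] (y : hV Q) : exists t, forall v, hmV q v = y -> t = hmV x v.
  by have [v <-] := qV y; exists (hmV x v) => v' /kV.
have /fin_all_exists[uE uEP] (y : hE Q) : exists t, forall v, hmE q v = y -> t = hmE x v.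
  by have [v <-] := qE y; exists (hmE x v) => v' /kE.
exists (Hom uV uE); split; last by split=> y /=; [apply: uVP | apply: uEP].
apply: is_hom_inc => [b y|y] /=; have [e <-] := qE y; rewrite (uEP _ e) //.
  rewrite !inc_hom // -map_comp; apply: eq_map => v /=.
  by rewrite (uVP _ v).
by rewrite !lab_hom.
Qed.

Lemma epi_cancel B Q T (q : hom B Q) (u u' : hom Q T) (x : hom B T) : epi q ->
  homeq (hcomp q u) x -> homeq (hcomp q u') x -> homeq u u'.
Proof.
move=> [qV qE] [uV uE] [uV' uE']; split=> y.
  by have [v <-] := qV y; have := uV v; have := uV' v => /= -> ->.
by have [v <-] := qE y; have := uE v; have := uE' v => /= -> ->.
Qed.

(* The doubling of [Q] outside the sub-hypergraph [(PV, PE)]. *)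
Lemma separate_outside Q (PV : pred (hV Q)) (PE : pred (hE Q)) : wf Q ->
  (forall b e v, PE e -> v \in inc b e -> PV v) ->
  exists T (u u' : hom Q T), [/\ wf T, is_hom u, is_hom u',
    (forall v, hmV u v = hmV u' v <-> PV v) & (forall e, hmE u e = hmE u' e <-> PE e)].
Proof.
move=> wQ cl.
pose fV c (v : hV Q) := (v, c && ~~ PV v); pose fE c (e : hE Q) := (e, c && ~~ PE e).
pose T := @Hyp Sg (hV Q * bool)%type (hE Q * bool)%type
  (fun e => map (fV e.2) (hsrc e.1)) (fun e => map (fV e.2) (htgt e.1)) (fun e => hlab e.1).
have incT b (e : hE T) : inc b e = map (fV e.2) (inc b e.1) by case: b.
have hu c : is_hom (@Hom Sg Q T (fV c) (fE c)).
  apply: is_hom_inc => // b e; rewrite incT /=; apply/eq_in_map => v ve.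
  rewrite /fV; case: (boolP (PE e)) => [pe|]; last by rewrite /= andbT.
  by rewrite /= (cl b e v) // !andbF.
exists T, (@Hom Sg Q T (fV false) (fE false)), (@Hom Sg Q T (fV true) (fE true)).
split=> //; first by apply: inc_wf => b e; rewrite incT size_map wf_inc.
  by move=> v /=; rewrite /fV /=; split=> [[/esym/negbFE]|->].
by move=> v /=; rewrite /fE /=; split=> [[/esym/negbFE]|->].
Qed.

(** Doubling [Q] outside the image of [q] gives two maps that agree after [q]; cancelling [q] makes
    them equal, so nothing lies outside the image. *)
Lemma jointly_epi B Q (q : hom B Q) : wf Q -> is_hom q ->
  (forall T (u u' : hom Q T), wf T -> is_hom u -> is_hom u' ->
     homeq (hcomp q u) (hcomp q u') -> homeq u u') -> epi q.
Proof.
move=> wQ hq can.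
have [|T [u [u' [wT hu hu' uV uE]]]] := separate_outside
    (PV := fun v => [exists x, hmV q x == v]) (PE := fun e => [exists x, hmE q x == e]) wQ.
  move=> b e v /existsP[x /eqP<-] /(mem_hom_inv hq)[w _ <-].
  by apply/existsP; exists w.
have [eV eE] : homeq u u'.
  apply: can => //; split=> x /=.
    by apply/uV/existsP; exists x.
  by apply/uE/existsP; exists x.
split=> y.
  by have /uV/existsP[x /eqP<-] := eV y; exists x.
by have /uE/existsP[x /eqP<-] := eE y; exists x.
Qed.

Lemma homeq_sym A B (f g : hom A B) : homeq f g -> homeq g f.
Proof. by move=> [h1 h2]; split=> x; rewrite ?h1 ?h2. Qed.

Lemma coeq_epi A B Q (f g : hom A B) (q : hom B Q) : is_coeq f g q -> epi q.
Proof.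
move=> [wQ [hq [[cV cE] un]]]; apply: jointly_epi => // T u u' wT hu hu' e.
have [|_ can] := un T (hcomp q u) wT (is_hom_comp hq hu).
  by split=> x /=; [rewrite (cV x : hmV q _ = _)|rewrite (cE x : hmE q _ = _)].
by apply: can => //; apply: homeq_sym.
Qed.

(** For surjective [q] the universal property reduces to a kernel condition: whatever [q] identifies
    must be identified by every map that coequalises [f] and [g]. *)
Lemma is_coeq_intro A B Q (f g : hom A B) (q : hom B Q) :
  wf Q -> is_hom q -> epi q -> homeq (hcomp f q) (hcomp g q) ->
  (forall T (x : hom B T), is_hom x -> homeq (hcomp f x) (hcomp g x) ->
    (forall v v', hmV q v = hmV q v' -> hmV x v = hmV x v') /\
    (forall e e', hmE q e = hmE q e' -> hmE x e = hmE x e')) ->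
  is_coeq f g q.
Proof.
move=> wQ hq eq e k; split=> //; split=> //; split=> // T x wT hx cx.
have [kV kE] := k T x hx cx; split; first exact: factor_hom.
by move=> u u' _ _; apply: epi_cancel.
Qed.

(* The pushout of the injection [a] along [b], elementwise. *)
Definition glued_fun (A B C D : Type) (a : A -> B) (b : A -> C) (c : B -> D) (d : C -> D) :=
  [/\ (forall k, c (a k) = d (b k)),
      (forall w, (exists x, c x = w) \/ (exists y, d y = w)),
      injective d,
      (forall x y, c x = d y -> exists k, a k = x /\ b k = y) &
      (forall x x', c x = c x' -> x = x' \/
         exists k k', [/\ a k = x, a k' = x' & b k = b k'])].

Definition glued A B C D (a : hom A B) (b : hom A C) (c : hom B D) (d : hom C D) :=
  glued_fun (hmV a) (hmV b) (hmV c) (hmV d) /\ glued_fun (hmE a) (hmE b) (hmE c) (hmE d).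

Lemma glued_epi A B C D (a : hom A B) (b : hom A C) (c : hom B D) (d : hom C D) :
  glued a b c d -> epi (copair c d).
Proof.
move=> [[_ sV _ _ _] [_ sE _ _ _]]; split=> y.
  by case: (sV y) => [[x <-]|[x <-]]; [exists (inl x)|exists (inr x)].
by case: (sE y) => [[x <-]|[x <-]]; [exists (inl x)|exists (inr x)].
Qed.

Lemma glued_fun_kernel (A B C D T : Type) (a : A -> B) (b : A -> C) (c : B -> D) (d : C -> D)
    (x : B -> T) (y : C -> T) :
  glued_fun a b c d -> (forall k, x (a k) = y (b k)) ->
  [/\ forall v v', c v = c v' -> x v = x v',
      forall v v', c v = d v' -> x v = y v' &
      forall v v', d v = d v' -> y v = y v'].
Proof.
move=> [_ _ dinj cd cc] xy; split=> v v'.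
- by case/cc=> [->//|[k [k' [<- <- e]]]]; rewrite !xy e.
- by case/cd=> k [<- <-].
- by move/dinj->.
Qed.

Lemma glued_kernel A B C D T (a : hom A B) (b : hom A C) (c : hom B D) (d : hom C D)
    (x : hom B T) (y : hom C T) :
  glued a b c d -> homeq (hcomp a x) (hcomp b y) ->
  (forall v v', hmV (copair c d) v = hmV (copair c d) v' ->
     hmV (copair x y) v = hmV (copair x y) v') /\
  (forall v v', hmE (copair c d) v = hmE (copair c d) v' ->
     hmE (copair x y) v = hmE (copair x y) v').
Proof.
move=> [gV gE] [xV xE].
have [V1 V2 V3] := glued_fun_kernel gV xV; have [E1 E2 E3] := glued_fun_kernel gE xE.
split=> -[v|v] [v'|v'] /=; try (by [apply: V1|apply: V2|apply: V3|apply: E1|apply: E2|apply: E3]).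
  by move=> e; rewrite (V2 v' v).
by move=> e; rewrite (E2 v' v).
Qed.

Lemma glued_wf A B C D (a : hom A B) (b : hom A C) (c : hom B D) (d : hom C D) :
  glued a b c d -> wf B -> wf C -> is_hom c -> is_hom d -> wf D.
Proof.
move=> [_ [_ sE _ _ _]] wB wC hc hd; apply: inc_wf => z e.
by case: (sE e) => [[x <-]|[x <-]]; rewrite inc_hom // size_map wf_inc // lab_hom.
Qed.

Lemma glued_pushout A B C D (a : hom A B) (b : hom A C) (c : hom B D) (d : hom C D) :
  wf B -> wf C -> is_hom c -> is_hom d -> glued a b c d -> is_pushout a b c d.
Proof.
move=> wB wC hc hd g; have wD := glued_wf g wB wC hc hd.
have [[cV _ _ _ _] [cE _ _ _ _]] := g.
do 4!split=> //; move=> T x y wT hx hy xy; have [kV kE] := glued_kernel g xy.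
have hcd := is_hom_copair hc hd; have ecd := glued_epi g.
have [u [hu [uV uE]]] := factor_hom hcd ecd (is_hom_copair hx hy) kV kE.
split.
  exists u; split=> //; split.
    by split=> v; [exact: (uV (inl v))|exact: (uE (inl v))].
  by split=> v; [exact: (uV (inr v))|exact: (uE (inr v))].
move=> v v' _ _ [V1 E1] [V2 E2] [V3 E3] [V4 E4].
apply: (epi_cancel (x := copair x y) ecd).
  by split=> -[w|w]; [exact: V1|exact: V2|exact: E1|exact: E2].
by split=> -[w|w]; [exact: V3|exact: V4|exact: E3|exact: E4].
Qed.

Lemma pushout_sym A B C D (a : hom A B) (b : hom A C) (c : hom B D) (d : hom C D) :
  is_pushout a b c d -> is_pushout b a d c.
Proof.
move=> [wD [hc [hd [e un]]]]; do 3!split=> //; split; first exact: homeq_sym.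
move=> T x y wT hx hy xy; have [[u [hu [h1 h2]]] can] := un T y x wT hy hx (homeq_sym xy).
split; first by exists u.
by move=> v v' hv hv' h3 h4 h5 h6; apply: can.
Qed.

Lemma glue_fun_exists (A B C : finType) (a : A -> B) (b : A -> C) : injective a ->
  exists (D : finType) (c : B -> D) (d : C -> D), glued_fun a b c d.
Proof.
(* The gluing is [C] plus the part of [B] outside the image of [a]; an element [a k] goes to [b k],
   unambiguously because [a] is injective. *)
move=> ainj; exists (C + {x : B | [forall k, a k != x]})%type.
have /fin_all_exists[c cP] (x : B) : exists w : C + {x : B | [forall k, a k != x]},
    (exists2 k, a k = x & w = inl (b k)) \/ (exists2 z, val z = x & w = inr z).
  case: (boolP [forall k, a k != x]) => [h|].
    by exists (inr (Sub x h)); right; exists (Sub x h).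
  by rewrite negb_forall => /existsP[k /negPn/eqP ak]; exists (inl (b k)); left; exists k.
have ca k : c (a k) = inl (b k).
  case: (cP (a k)) => [[k' /ainj-> //]|[[x xP] /= ex _]].
  by move/forallP: xP => /(_ k); rewrite ex eqxx.
exists c, inl; split=> //.
- case=> [y|[x xP]]; [by right; exists y | left; exists x].
  case: (cP x) => [[k ak]|[z zx ->]]; first by move/forallP: (xP) => /(_ k); rewrite ak eqxx.
  by congr inr; apply: val_inj.
- by move=> x y [].
- by move=> x y; case: (cP x) => [[k ak ->] [by_]|[z _ ->] //]; exists k.
- move=> x x'; case: (cP x) => [[k ak ->]|[z <- ->]]; case: (cP x') => [[k' ak' ->]|[z' <- ->]] //.
    by case=> bb; right; exists k, k'.
  by case=> ->; left.
Qed.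

(** Nodes and hyperedges are glued separately. The incidence lists and the label of a glued
    hyperedge are read off any preimage; the description of the kernel shows that the choice does
    not matter. *)
Lemma glue_exists A B C (a : hom A B) (b : hom A C) :
  is_hom a -> is_hom b -> mono a -> wf B -> wf C ->
  exists D (c : hom B D) (d : hom C D),
    [/\ wf D, is_hom c, is_hom d & glued a b c d].
Proof.
move=> ha hb [aV aE] wB wC.
have [DV [cV [dV gV]]] := glue_fun_exists (hmV b) aV.
have [DE [cE [dE gE]]] := glue_fun_exists (hmE b) aE.
have comm z k : map cV (inc z (hmE a k)) = map dV (inc z (hmE b k)).
  by rewrite !inc_hom // -!map_comp; apply: eq_map => v /=; case: gV.
have inc_ex z : forall w : DE, exists s : seq DV,
    (forall x, cE x = w -> s = map cV (inc z x)) /\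
    (forall y, dE y = w -> s = map dV (inc z y)).
  have [eE sE dE_inj cdE ccE] := gE.
  move=> w; case: (sE w) => [[x <-]|[y <-]].
    exists (map cV (inc z x)); split=> [x' /ccE|y /esym/cdE[k [<- <-]]] //.
    by case=> [->//|[k [k' [<- <- e]]]]; rewrite !comm e.
  exists (map dV (inc z y)); split=> [x /cdE[k [<- <-]]|y' /dE_inj->//].
  by rewrite comm.
have lab_ex : forall w : DE, exists s : sym Sg,
    (forall x, cE x = w -> s = hlab x) /\ (forall y, dE y = w -> s = hlab y).
  have [eE sE dE_inj cdE ccE] := gE.
  move=> w; case: (sE w) => [[x <-]|[y <-]].
    exists (hlab x); split=> [x' /ccE|y /esym/cdE[k [<- <-]]]; last by rewrite !lab_hom.
    by case=> [->//|[k [k' [<- <- e]]]]; rewrite (lab_hom k ha) (lab_hom k' ha) -(lab_hom k hb) e lab_hom.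
  exists (hlab y); split=> [x /cdE[k [<- <-]]|y' /dE_inj->//].
  by rewrite !lab_hom.
have [s sP] := fin_all_exists (inc_ex true).
have [t tP] := fin_all_exists (inc_ex false).
have [l lP] := fin_all_exists lab_ex.
pose D := @Hyp Sg DV DE s t l.
have hc : is_hom (@Hom Sg B D cV cE).
  move=> e; split; first by apply: (sP _).1.
  by split; [apply: (tP _).1 | apply: (lP _).1].
have hd : is_hom (@Hom Sg C D dV dE).
  move=> e; split; first by apply: (sP _).2.
  by split; [apply: (tP _).2 | apply: (lP _).2].
exists D, (@Hom Sg B D cV cE), (@Hom Sg C D dV dE); split=> //.
by apply: (glued_wf (a := a) (b := b)) hc hd.
Qed.

(* Compare an abstract pushout with the concrete gluing: the mediating map
   reflects equality, the universal property gives joint surjectivity. *)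
Lemma pushout_glued A B C D (a : hom A B) (b : hom A C) (c : hom B D) (d : hom C D) :
  is_hom a -> is_hom b -> mono a -> wf B -> wf C -> is_pushout a b c d -> glued a b c d.
Proof.
move=> ha hb ma_ wB wC [wD [hc [hd [[eV eE] un]]]].
have [D' [c' [d' [wD' hc' hd' g']]]] := glue_exists ha hb ma_ wB wC.
have [[eV' _ dV' cdV' ccV'] [eE' _ dE' cdE' ccE']] := g'.
have [[u [hu [[ucV ucE] [udV udE]]]] _] := un D' c' d' wD' hc' hd' (conj eV' eE').
have [sV sE] : epi (copair c d).
  apply: jointly_epi => //; first exact: is_hom_copair.
  move=> T v v' wT hv hv' [vV vE].
  have [|_ can] := un T (hcomp c v) (hcomp d v) wT (is_hom_comp hc hv) (is_hom_comp hd hv).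
    by split=> k /=; [rewrite (eV k : hmV c _ = _)|rewrite (eE k : hmE c _ = _)].
  apply: can => //; split=> w /=; apply/esym;
    by [exact: (vV (inl w))|exact: (vV (inr w))|exact: (vE (inl w))|exact: (vE (inr w))].
split; split=> //.
- by move=> w; have [[x|x] <-] := sV w; [left|right]; exists x.
- by move=> x y e; apply: dV'; rewrite -!udV /= e.
- by move=> x y e; apply: cdV'; rewrite -udV -ucV /= e.
- by move=> x y e; apply: ccV'; rewrite -!ucV /= e.
- by move=> w; have [[x|x] <-] := sE w; [left|right]; exists x.
- by move=> x y e; apply: dE'; rewrite -!udE /= e.
- by move=> x y e; apply: cdE'; rewrite -udE -ucE /= e.
- by move=> x y e; apply: ccE'; rewrite -!ucE /= e.
Qed.

Lemma lift_mono A C G (i : hom C G) (h : hom A G) :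
  is_hom i -> mono i -> is_hom h ->
  (forall v, exists w, hmV i w = hmV h v) -> (forall e, exists w, hmE i w = hmE h e) ->
  exists h' : hom A C, is_hom h' /\ homeq (hcomp h' i) h.
Proof.
move=> hi [iV iE] hh /fin_all_exists[fV fVP] /fin_all_exists[fE fEP].
exists (Hom fV fE); split; last by split=> x /=.
apply: is_hom_inc => [b e|e] /=.
  apply: (inj_map iV); rewrite -inc_hom // fEP inc_hom // -map_comp.
  by apply: eq_map => v /=.
by rewrite -(lab_hom _ hi) fEP lab_hom.
Qed.

Lemma sub_exists G (PV : pred (hV G)) (PE : pred (hE G)) : wf G ->
  (forall b e v, PE e -> v \in inc b e -> PV v) ->
  exists C (i : hom C G), [/\ wf C, is_hom i, mono i,
    (forall v, (exists w, hmV i w = v) <-> PV v) & (forall e, (exists w, hmE i w = e) <-> PE e)].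
Proof.
move=> wG cl.
pose VC : finType := {v | PV v}; pose EC : finType := {e | PE e}.
(* [insub] would drop nodes outside [PV]; the closure hypothesis [cl] ensures that none is dropped,
   so arities survive. *)
pose C := @Hyp Sg VC EC (fun e => pmap insub (hsrc (val e)))
  (fun e => pmap insub (htgt (val e))) (fun e => hlab (val e)).
have incC b (e : EC) : map val (inc b (e : hE C)) = inc b (val e).
  have -> : inc b (e : hE C) = pmap insub (inc b (val e)) by case: b.
  rewrite (pmap_filter (insubK _)); apply/all_filterP/allP => v ve.
  by rewrite isSome_insub; apply: cl ve; apply: valP.
have hi : is_hom (@Hom Sg C G val val) by apply: is_hom_inc => [b e|//]; rewrite incC.
exists C, (@Hom Sg C G val val); split=> //.
- by apply: inc_wf => b e; rewrite -(size_map val) incC wf_inc.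
- by split; apply: val_inj.
- by move=> v; split=> [[w <-]|pv]; [apply: valP | exists (Sub v pv)].
- by move=> v; split=> [[w <-]|pv]; [apply: valP | exists (Sub v pv)].
Qed.

(** * Matches into monogamous acyclic hypergraphs *)

Lemma bdry_hom b L G (m : hom L G) a : is_hom m -> bdry b (hmV m a) -> bdry b a.
Proof.
move=> hm /bdryP h; apply/bdryP => e; apply/negP => /(mem_inc_hom hm).
by apply/negP.
Qed.

(** Inside [L] the node [a] already has an incidence on side [b]; by monogamy its image has no other
    one in [G]. *)
Lemma match_edge b L G (m : hom L G) a e : is_hom m -> ma G -> ~~ bdry b a ->
  hmV m a \in inc b e -> exists e0, hmE m e0 = e.
Proof.
move=> hm mG /bdryPn[e0 [k ek]] ae; exists e0.
apply: (deg_le1_mem (ma_deg b _ mG)) ae; apply: mem_inc_hom => //.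
by apply/onthP; exists k.
Qed.

(** An isolated node would be both input and output, and strong connectedness would demand a path,
    hence a hyperedge, starting at it. *)
Lemma sc_not_isolated L (v : hV L) : strongly_connected L -> bdry true v -> ~ bdry false v.
Proof.
move=> sc vo vi; have /path_from_toP[e [_ [_ ve _]]] := sc v v vi vo.
by move/bdryP: vo => /(_ e); rewrite ve.
Qed.

(** A path in [G] from the output [b] back to the input [a] would close a cycle with the image of a
    path from [a] to [b] in [L]. *)
Lemma sc_no_return L G (m : hom L G) a b e e' :
  is_hom m -> ma G -> strongly_connected L -> bdry false a -> bdry true b ->
  hmV m b \in inc true e -> hmV m a \in inc false e' -> ~ connect (@adj _ G) e e'.
Proof.
move=> hm [/acyclicP nc _] sc ai bo be ae' c.
have /path_from_toP[e1 [e2 [c12 ae1 be2]]] := sc a b ai bo.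
apply: (nc e (hmE m e2)); last first.
  by apply/adjP; exists (hmV m b) => //; apply: mem_inc_hom.
apply: connect_trans c (connect_trans (connect1 _) (connect_hom hm c12)).
by apply/adjP; exists (hmV m a) => //; apply: mem_inc_hom.
Qed.

Lemma sc_in_out_apart L G (m : hom L G) a b :
  is_hom m -> ma G -> strongly_connected L -> bdry false a -> bdry true b ->
  hmV m a <> hmV m b.
Proof.
move=> hm [/acyclicP nc _] sc ai bo ab.
have /path_from_toP[e1 [e2 [c12 ae1 be2]]] := sc a b ai bo.
apply: (nc _ _ (connect_hom hm c12)); apply/adjP; exists (hmV m b).
  exact: mem_inc_hom.
by rewrite -ab; apply: mem_inc_hom.
Qed.

(** By monogamy of [G] the images of [x] and [y] sit at the same position of the same hyperedge, and
    injectivity on hyperedges carries this back to [L]. *)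
Lemma nonbdry_inj b L G (m : hom L G) x y : is_hom m -> ma G -> injective (hmE m) ->
  ~~ bdry b x -> ~~ bdry b y -> hmV m x = hmV m y -> x = y.
Proof.
move=> hm mG mE /bdryPn[e [k ek]] /bdryPn[e' [k' ek']] xy.
have ek2 := onth_inc_hom hm ek'; rewrite -xy in ek2.
have [/mE ee kk] := (deg_le1P b (hmV m x)).1 (ma_deg b _ mG) _ _ _ _ (onth_inc_hom hm ek) ek2.
by move: ek'; rewrite -ee -kk ek => -[].
Qed.

Lemma mono_of_mono_edges L G (m : hom L G) :
  is_hom m -> ma G -> strongly_connected L -> injective (hmE m) -> mono m.
Proof.
move=> hm mG sc mE; split=> // x y xy.
have nb (v : hV L) : bdry true v -> ~~ bdry false v by move=> h; apply/negP; apply: sc_not_isolated.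
have inj := nonbdry_inj hm mG mE.
case: (boolP (bdry true x)) => [xo|xo]; case: (boolP (bdry true y)) => [yo|yo].
- by apply: (inj false) => //; apply: nb.
- case: (boolP (bdry false y)) => [yi|yi]; last by apply: (inj false) => //; apply: nb.
  by case: (sc_in_out_apart hm mG sc yi xo).
- case: (boolP (bdry false x)) => [xi|xi]; last by apply: (inj false) => //; apply: nb.
  by case: (sc_in_out_apart hm mG sc xi yo).
- exact: (inj true).
Qed.

(** A path starting in the match stays in it until it passes an output of [L]: at any other node of
    the match the next hyperedge is again in the match by [match_edge]. *)
Lemma path_leaves L G (m : hom L G) x e p : is_hom m -> ma G ->
  path (@adj _ G) e p -> hmV m x \in inc true e -> (forall e0, hmE m e0 <> last e p) ->
  exists a e1, [/\ bdry true a, hmV m a \in inc true e1 & connect (@adj _ G) e1 (last e p)].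
Proof.
move=> hm mG; elim: p e x => [|e' p ih] e x /=.
  move=> _ xe ne; exists x, e; split=> //; apply: contraT => nb.
  by have [e0 /ne] := match_edge hm mG nb xe.
move=> /andP[a pp] xe ne.
case: (boolP (bdry true x)) => [bx|nb].
  exists x, e; split=> //; apply: connect_trans (connect1 a) _.
  by apply/connectP; exists p.
have [e0 ee] := match_edge hm mG nb xe.
case/adjP: a => v; rewrite -ee => /(mem_hom_inv hm)[w _ <-] we'.
exact: ih pp we' ne.
Qed.

(** Dual of [path_leaves]: the first hyperedge of the path that lies in the match is entered through
    an input of [L]. *)
Lemma path_enters L G (m : hom L G) y e p : is_hom m -> ma G ->
  path (@adj _ G) e p -> hmV m y \in inc false (last e p) -> (forall e0, hmE m e0 <> e) ->
  exists a e1, [/\ bdry false a, hmV m a \in inc false e1 & connect (@adj _ G) e e1].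
Proof.
move=> hm mG; elim: p e => [|e' p ih] e /=.
  move=> _ ye ne; exists y, e; split=> //; apply: contraT => nb.
  by have [e0 /ne] := match_edge hm mG nb ye.
move=> /andP[a pp] ye ne.
case: (boolP [exists e0, hmE m e0 == e']) => [/existsP[e0 /eqP ee]|/existsPn h].
  case/adjP: (a) => v ve; rewrite -ee => /(mem_hom_inv hm)[w _ wv].
  exists w, e; rewrite wv; split=> //; apply: contraT => nb.
  by rewrite -wv in ve; have [e1 /ne] := match_edge hm mG nb ve.
have [|b [e1 [bb be1 c]]] := ih e' pp ye; first by move=> e0; apply/eqP.
by exists b, e1; split=> //; apply: connect_trans (connect1 a) c.
Qed.

Lemma sc_convex L G (m : hom L G) :
  is_hom m -> ma G -> strongly_connected L -> convex m.
Proof.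
move=> hm mG sc x y [|e0 p] // [pp [xe0 ye]] e ep.
case: (boolP [exists f, hmE m f == e]) => [/existsP[f /eqP ee]|/existsPn h]; first by exists f.
exfalso; case/splitPl: {p}ep pp ye => p1 p2 le.
rewrite cat_path last_cat le => /andP[pp1 pp2] ye.
have ne f : hmE m f <> e by apply/eqP.
(* The part of the path up to [e] leaves the match at an output [a], the part from [e] on re-enters
   it at an input [b], which [sc_no_return] forbids. *)
have [|a [e1 [ao ae1 c1]]] := path_leaves hm mG pp1 xe0; first by rewrite le.
have [b [e2 [bi be2 c2]]] := path_enters hm mG pp2 ye ne.
apply: (sc_no_return hm mG sc bi ao ae1 be2); apply: connect_trans c2.
by rewrite -le.
Qed.

(** * Rewriting steps *)

(* The interface nodes that lie on side [b]: inputs have no incoming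
   hyperedge, outputs no outgoing one. *)
Definition side b (U V : Type) (k : U + V) : bool := if k is inl _ then ~~ b else b.

Lemma cospan_bdry (I O H : hyp Sg) (fi : hom I H) (fo : hom O H) : ma_cospan fi fo ->
  forall b v, bdry b v <-> exists k, side b k /\ hmV (copair fi fo) k = v.
Proof.
move=> [_ [_ [_ [_ [_ [_ [_ [_ [hi ho]]]]]]]]] [] v.
  split=> [/ho[x <-]|[[x|x] [//= _ <-]]]; first by exists (inr x).
  by apply/ho; exists x.
split=> [/hi[x <-]|[[x|x] [//= _ <-]]]; first by exists (inl x).
by apply/hi; exists x.
Qed.

Lemma cospan_inj (I O H : hyp Sg) (fi : hom I H) (fo : hom O H) : ma_cospan fi fo ->
  forall b k k', side b k -> side b k' ->
    hmV (copair fi fo) k = hmV (copair fi fo) k' -> k = k'.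
Proof.
move=> [_ [_ [_ [_ [_ [_ [[fiI _] [[foI _] _]]]]]]]] [] [x|x] [y|y] //= _ _.
  by move/foI->.
by move/fiI->.
Qed.

Lemma discrete_void A : is_discrete A -> hE A -> False.
Proof. by move=> d e; have := card0_eq d e; rewrite inE. Qed.

Lemma ma_cospan_intro (I O H : hyp Sg) (fi : hom I H) (fo : hom O H) :
  is_discrete I -> is_discrete O -> wf H -> ma H ->
  (forall b v, bdry b v <-> exists k, side b k /\ hmV (copair fi fo) k = v) ->
  (forall b k k', side b k -> side b k' ->
    hmV (copair fi fo) k = hmV (copair fi fo) k' -> k = k') ->
  ma_cospan fi fo.
Proof.
move=> dI dO wH mH hb hinj; have nI := discrete_void dI; have nO := discrete_void dO.
do 4!split=> //; do 2!(split; first by move=> e; case: (nI e) || case: (nO e)).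
split.
  split=> [x y xy|e]; last by case: (nI e).
  by have [] := hinj false (inl x) (inl y) isT isT xy.
split.
  split=> [x y xy|e]; last by case: (nO e).
  by have [] := hinj true (inr x) (inr y) isT isT xy.
split=> v.
  split=> [/(hb false v)[[x|x] [//= _ <-]]|[x <-]]; first by exists x.
  by apply/(hb false); exists (inl x).
split=> [/(hb true v)[[x|x] [//= _ <-]]|[x <-]]; first by exists x.
by apply/(hb true); exists (inr x).
Qed.

Lemma lc_void (r : rule Sg) : left_connected_rule r -> hE (rK r) -> False.
Proof. by move=> [/discrete_void dI [/discrete_void dO _]] [/dI|/dO]. Qed.

Lemma lc_hom_rf (r : rule Sg) : left_connected_rule r -> is_hom (rf r).
Proof. by move=> lc e; case: (lc_void lc e). Qed.

Lemma lc_hom_rg (r : rule Sg) : left_connected_rule r -> is_hom (rg r).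
Proof. by move=> lc e; case: (lc_void lc e). Qed.

Lemma lc_wf (r : rule Sg) : left_connected_rule r -> wf (rL r).
Proof. by move=> [_ [_ [[_ [_ []]]]]]. Qed.

Lemma lc_wfR (r : rule Sg) : left_connected_rule r -> wf (rR r).
Proof. by move=> [_ [_ [_ [[_ [_ []]]]]]]. Qed.

Lemma lc_mono (r : rule Sg) : left_connected_rule r -> mono (rf r).
Proof. by move=> [_ [_ [_ [_ []]]]]. Qed.

Lemma lc_sc (r : rule Sg) : left_connected_rule r -> strongly_connected (rL r).
Proof. by move=> [_ [_ [_ [_ []]]]]. Qed.

Lemma lc_bdryL (r : rule Sg) b (v : hV (rL r)) : left_connected_rule r ->
  bdry b v <-> exists k, side b k /\ hmV (rf r) k = v.
Proof. by move=> [_ [_ [/cospan_bdry h _]]]; apply: h. Qed.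

Lemma lc_bdry_rf (r : rule Sg) b (k : hV (rK r)) : left_connected_rule r ->
  bdry b (hmV (rf r) k) = side b k.
Proof.
move=> lc; apply/idP/idP => [/(lc_bdryL _ _ lc)[k' [s /(lc_mono lc).1<- //]]|s].
by apply/(lc_bdryL _ _ lc); exists k.
Qed.

(** * A single rewriting step: monogamy, boundary and acyclicity of the result *)

Section Step.
Variables (r : rule Sg) (G C H : hyp Sg).
Variables (m : hom (rL r) G) (i : hom C G) (kC : hom (rK r) C).
Variables (c : hom C H) (d : hom (rR r) H).
Hypotheses (lc : left_connected_rule r) (maG : ma G).
Hypotheses (hm : is_hom m) (hi : is_hom i) (hc : is_hom c) (hd : is_hom d).
Hypotheses (gL : glued (rf r) kC m i) (gR : glued kC (rg r) c d).
Hypothesis mV : injective (hmV m).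

Let kCi k : hmV i (hmV kC k) = hmV m (hmV (rf r) k).
Proof. by case: gL => -[->]. Qed.

Let kCc k : hmV c (hmV kC k) = hmV d (hmV (rg r) k).
Proof. by case: gR => -[->]. Qed.

Let miE e e' : hmE m e <> hmE i e'.
Proof. by case: gL => _ [_ _ _ h _] /h[k]; case: (lc_void lc k). Qed.

Let cdE e e' : hmE c e <> hmE d e'.
Proof. by case: gR => _ [_ _ _ h _] /h[k]; case: (lc_void lc k). Qed.

Let cE_inj : injective (hmE c).
Proof. by case: gR => _ [_ _ _ _ h] x y /h[//|[k]]; case: (lc_void lc k). Qed.

Let iV_inj : injective (hmV i). Proof. by case: gL => -[]. Qed.
Let iE_inj : injective (hmE i). Proof. by case: gL => _ []. Qed.
Let dV_inj : injective (hmV d). Proof. by case: gR => -[]. Qed.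
Let dE_inj : injective (hmE d). Proof. by case: gR => _ []. Qed.

Let bdryR b v : bdry b v <-> exists k, side b k /\ hmV (rg r) k = v.
Proof. by case: lc => _ [_ [_ [/cospan_bdry h _]]]; apply: h. Qed.

Let rg_inj b k k' : side b k -> side b k' -> hmV (rg r) k = hmV (rg r) k' -> k = k'.
Proof. by case: lc => _ [_ [_ [/cospan_inj h _]]]; apply: h. Qed.

Let maR : ma (rR r). Proof. by case: lc => _ [_ [_ [[_ [_ [_ [h _]]]] _]]]. Qed.

(** Hyperedges of the complement meet the match from outside only: they have sources at outputs of
    [L] and targets at inputs. Otherwise monogamy would put them into the match. *)
Lemma complement_side b k e : hmV kC k \in inc b e -> side b k.
Proof.
move=> ke; apply: contraT; rewrite -(lc_bdry_rf b k lc) => nb.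
have mke := mem_inc_hom hi ke; rewrite kCi in mke.
by have [e0 /miE] := match_edge hm maG nb mke.
Qed.

(** At a glued node the complement and [R] use opposite sides: the incidence in [C] puts the
    interface node on side [b], where [R] has no hyperedge. *)
Lemma step_apart b e r0 v w : v \in inc b e -> w \in inc b r0 -> hmV c v <> hmV d w.
Proof.
move=> ve wr vw; have [_ _ _ cd _] := gR.1; have [k [kv rw]] := cd _ _ vw.
rewrite -kv in ve; have s := complement_side ve.
have /bdryP/(_ r0)/negP : bdry b w by apply/bdryR; exists k.
exact.
Qed.

(** The map [rg r] may identify an input with an output, so [c] need not be injective; it is
    injective on nodes with an incidence on one common side. *)
Lemma step_inj b e e' v v' : v \in inc b e -> v' \in inc b e' -> hmV c v = hmV c v' -> v = v'.
Proof.
move=> ve ve'; have [_ _ _ _ cc] := gR.1; case/cc=> // -[k [k' [kv kv' rr]]].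
subst v v'; congr (hmV kC _); exact: (rg_inj (complement_side ve) (complement_side ve') rr).
Qed.

Lemma step_deg b (w : hV H) : deg b w <= 1.
Proof.
apply/deg_le1P => h k h' k'; have [_ sE _ _ _] := gR.2.
case: (sE h) => [[e <-]|[e <-]]; case: (sE h') => [[e' <-]|[e' <-]].
- move=> /(onth_hom_inv hc)[v ve <-] /(onth_hom_inv hc)[v' ve' vv].
  have ev: v = v'.
    by apply: (step_inj (b := b) (e := e) (e' := e')) => //; apply/onthP; [exists k|exists k'].
  subst v'; have [/iE_inj-> ->//] := (deg_le1P b (hmV i v)).1 (ma_deg b _ maG) _ _ _ _
    (onth_inc_hom hi ve) (onth_inc_hom hi ve').
- move=> /(onth_hom_inv hc)[v ve <-] /(onth_hom_inv hd)[v' ve' /esym vv].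
  by case: (step_apart (b := b) (e := e) (r0 := e') _ _ vv); apply/onthP; [exists k|exists k'].
- move=> /(onth_hom_inv hd)[v ve <-] /(onth_hom_inv hc)[v' ve' vv].
  by case: (step_apart (b := b) (e := e') (r0 := e) _ _ vv); apply/onthP; [exists k'|exists k].
- move=> /(onth_hom_inv hd)[v ve <-] /(onth_hom_inv hd)[v' ve' /dV_inj vv]; subst v'.
  by have [-> ->] := (deg_le1P b v).1 (ma_deg b _ maR) _ _ _ _ ve ve'.
Qed.

Let bdry_side b k : bdry b (hmV i (hmV kC k)) -> side b k.
Proof. by rewrite kCi => /(bdry_hom hm); rewrite lc_bdry_rf. Qed.

Lemma step_bdry_inj b v v' : bdry b (hmV i v) -> bdry b (hmV i v') ->
  hmV c v = hmV c v' -> v = v'.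
Proof.
move=> bv bv'; have [_ _ _ _ cc] := gR.1; case/cc=> // -[k [k' [kv kv' rr]]].
by subst v v'; congr (hmV kC _); apply: (rg_inj (bdry_side bv) (bdry_side bv') rr).
Qed.

Lemma step_bdry b w : bdry b w <-> exists v, bdry b (hmV i v) /\ hmV c v = w.
Proof.
have [_ sV _ cd cc] := gR.1; have [_ sE _ _ _] := gR.2; have [_ sLE _ _ _] := gL.2.
have [_ _ _ mi _] := gL.1.
(* A hyperedge of [G] at the image of [v] comes from [L] or from [C]. The first is impossible at an
   interface node on side [b], the second would reappear in [H]. *)
have key v : bdry b (hmV c v) -> (forall k, hmV kC k = v -> side b k) -> bdry b (hmV i v).
  move=> bw sv; apply/bdryP => g; case: (sLE g) => [[e <-]|[e <-]]; apply/negP.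
    move=> /(mem_hom_inv hm)[a ae /mi[k [ka kv]]].
    have /bdryP/(_ e)/negP : bdry b a by rewrite -ka lc_bdry_rf ?sv.
    by apply.
  move=> /(mem_hom_inv hi)[v' v'e /iV_inj vv]; subst v'.
  by move/bdryP: bw => /(_ (hmE c e)); rewrite mem_inc_hom.
split=> [bw|[v [bv <-]]].
  (* A node of [R] that is boundary in [H] is boundary in [R], hence an interface node, and its copy
     in [C] is the required preimage. *)
  have dcase x : hmV d x = w -> exists v, bdry b (hmV i v) /\ hmV c v = w.
    move=> dx; rewrite -dx in bw.
    have /bdryR[k [sk kx]] := bdry_hom hd bw.
    exists (hmV kC k); rewrite kCc kx dx; split=> //.
    have kC_inj : injective (hmV kC).
      by move=> k1 k2 kk; apply: (lc_mono lc).1; apply: mV; rewrite -!kCi kk.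
    by apply: key => [|k' /kC_inj-> //]; rewrite kCc kx.
  case: (sV w) => [[v cv]|[x dx]]; last exact: dcase dx.
  case: (boolP [exists k, hmV kC k == v]) => [/existsP[k /eqP kv]|/existsPn nk].
    by apply: (dcase (hmV (rg r) k)); rewrite -kCc kv.
  exists v; split=> //; apply: key => [|k kv]; first by rewrite cv.
  by have := nk k; rewrite kv eqxx.
apply/bdryP => h; apply/negP; case: (sE h) => [[e <-]|[e <-]].
  move=> /(mem_hom_inv hc)[v' v'e /esym].
  case/cc=> [vv|[k [k' [kv kv' rr]]]].
    by subst v'; move/bdryP: bv => /(_ (hmE i e)); rewrite mem_inc_hom.
  subst v v'; have kk := rg_inj (bdry_side bv) (complement_side v'e) rr; subst k'.
  by move/bdryP: bv => /(_ (hmE i e)); rewrite mem_inc_hom.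
move=> /(mem_hom_inv hd)[x xe /esym/cd[k [kv rx]]]; subst v x.
have /bdryP/(_ e)/negP : bdry b (hmV (rg r) k) by apply/bdryR; exists k; rewrite bdry_side.
by apply.
Qed.

(* A hyperedge of [C] reachable from an output of the match has level 2, the
   hyperedges of [R] have level 1 and the others level 0; refining the level by
   ranks in [G] and [R] gives a rank in [H]. Strong connectedness of [L]
   excludes that a hyperedge entering an input of the match has level 2. *)
Lemma step_acyclic (l : seq (hE H)) : ~ is_cycle l.
Proof.
have [rkG [rkG_le rkGP]] := acyclic_rank maG.1.
have [rkR [rkR_le rkRP]] := acyclic_rank maR.1.
(* [B] exceeds every rank in [G] and in [R], so a rise in level outweighs any change of rank. *)
pose B := (#|hE G| + #|hE (rR r)|).+1.
pose after e := [exists k, exists e0, [&& side true k,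
  hmV m (hmV (rf r) k) \in inc true e0 & connect (@adj _ G) e0 (hmE i e)]].
have after_out k e : hmV kC k \in inc true e -> after e.
  move=> ke; apply/existsP; exists k; apply/existsP; exists (hmE i e).
  by rewrite (complement_side ke) connect0 -kCi mem_inc_hom.
have before_in k e : hmV kC k \in inc false e -> ~~ after e.
  move=> ke; apply/negP => /existsP[k' /existsP[e0 /and3P[s' k'e0 ce0]]].
  have ke' := mem_inc_hom hi ke; rewrite kCi in ke'.
  apply: (sc_no_return hm maG (lc_sc lc) _ _ k'e0 ke' ce0); rewrite lc_bdry_rf //.
  exact: complement_side ke.
have after_adj e e' : adj (hmE i e) (hmE i e') -> after e -> after e'.
  move=> a /existsP[k /existsP[e0 /and3P[s ke0 ce0]]].
  apply/existsP; exists k; apply/existsP; exists e0; rewrite s ke0 /=.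
  exact: connect_trans ce0 (connect1 a).
have [_ sE _ _ _] := gR.2; have [_ _ _ cd cc] := gR.1.
have /fin_all_exists[rk rkP] (h : hE H) : exists n,
    (forall e, hmE c e = h -> n = (after e).*2 * B + rkG (hmE i e)) /\
    (forall e, hmE d e = h -> n = B + rkR e).
  case: (sE h) => [[e <-]|[e <-]].
    exists ((after e).*2 * B + rkG (hmE i e)).
    by split=> [e' /cE_inj->|e' /esym/cdE].
  by exists (B + rkR e); split=> [e' /cdE|e' /dE_inj->].
have rkc e : rk (hmE c e) = (after e).*2 * B + rkG (hmE i e) by apply: (rkP _).1.
have rkd e : rk (hmE d e) = B + rkR e by apply: (rkP _).2.
have ltG e : rkG (hmE i e) < B by rewrite ltnS (leq_trans (rkG_le _)) ?leq_addr.
have ltR e : rkR e < B by rewrite ltnS (leq_trans (rkR_le _)) ?leq_addl.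
apply: (rank_acyclic (rk := rk)) => {l} h h' /adjP[w].
case: (sE h) => [[e <-]|[e <-]]; case: (sE h') => [[e' <-]|[e' <-]].
- move=> /(mem_hom_inv hc)[v ve <-] /(mem_hom_inv hc)[v' ve' /esym/cc].
  case=> [vv|[k [k' [kv kv' _]]]].
    subst v'; have a : adj (hmE i e) (hmE i e').
      by apply/adjP; exists (hmV i v); apply: mem_inc_hom.
    rewrite !rkc -addnS leq_add ?rkGP // leq_mul2r leq_double.
    by case: (after e) (after_adj _ _ a) => // ->; rewrite ?orbT.
  (* Here an input [k] and an output [k'] have merged in [R]: [e] enters the match, at level 0, and
     [e'] leaves it, at level 2. *)
  rewrite -kv in ve; rewrite -kv' in ve'.
  rewrite !rkc (negPf (before_in _ _ ve)) (after_out _ _ ve') /= mul0n add0n.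
  by apply: leq_trans (ltG _) _; rewrite mul2n -addnn -addnA leq_addr.
- move=> /(mem_hom_inv hc)[v ve <-] /(mem_hom_inv hd)[x xe' /esym/cd[k [kv _]]].
  rewrite -kv in ve; rewrite rkc rkd (negPf (before_in _ _ ve)) mul0n add0n.
  by apply: leq_trans (ltG _) (leq_addr _ _).
- move=> /(mem_hom_inv hd)[x xe <-] /(mem_hom_inv hc)[v ve' /cd[k [kv _]]].
  rewrite -kv in ve'; rewrite rkc rkd (after_out _ _ ve') mul2n -addnn -addnA ltn_add2l.
  by apply: leq_trans (ltR _) (leq_addr _ _).
- move=> /(mem_hom_inv hd)[x xe <-] /(mem_hom_inv hd)[x' xe' /dV_inj xx].
  by subst x'; rewrite !rkd ltn_add2l; apply: rkRP; apply/adjP; exists x.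
Qed.

Lemma step_ma : ma H.
Proof. by split=> [l|v]; [exact: step_acyclic | split; [exact: (step_deg false)|exact: (step_deg true)]]. Qed.

End Step.

(** The complement [C] is [G] without the hyperedges of the match and without the images of interior
    nodes of [L]. Both [rK r] and the outer interface lift to it, and [H] is the gluing of [C] and
    [R]. *)
Lemma deriv_exists (r : rule Sg) (n n' G : hyp Sg) (nG : hom n G) (n'G : hom n' G)
    (m : hom (rL r) G) :
  left_connected_rule r -> ma_cospan nG n'G -> is_hom m -> mono m ->
  exists dd : deriv r nG n'G, is_deriv dd /\ dmatch dd = m.
Proof.
move=> lc cG hm [mV mE]; have [dn [dn' [wG [maG [hn [hn' _]]]]]] := cG.
have [|C [i [wC hi mi iV iE]]] := sub_exists
  (PV := fun v => [forall a, (hmV m a == v) ==> (bdry true a || bdry false a)])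
  (PE := fun e => [forall a, hmE m a != e]) wG.
  (* [C] is closed under incidence: a hyperedge at the image of an interior node belongs to the
     match. *)
  move=> b e v /forallP ne ve; apply/forallP => a; apply/implyP => /eqP av; subst v.
  suff: bdry b a by case: b {ve} => ->; rewrite ?orbT.
  apply: contraT => nb; have [e0 ee] := match_edge hm maG nb ve.
  by have := ne e0; rewrite ee eqxx.
have [|e|kC [hkC [kCV kCE]]] := lift_mono hi mi (is_hom_comp (lc_hom_rf lc) hm).
- move=> k; apply/iV/forallP => a; apply/implyP => /eqP/mV->.
  by rewrite !lc_bdry_rf //; case: k.
- by case: (lc_void lc e).
have [|e|nC [hnC [nCV nCE]]] := lift_mono hi mi (is_hom_copair hn hn').
(* An interface node of [G] is boundary in [G], so any preimage in [L] is boundary there and the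
   node survives in [C]. *)
- move=> k; apply/iV/forallP => a; apply/implyP => /eqP ak.
  have: bdry true (hmV (copair nG n'G) k) || bdry false (hmV (copair nG n'G) k).
    case: k {ak} => k; apply/orP; [right|left]; apply/(cospan_bdry cG);
      [by exists (inl k)|by exists (inr k)].
  by rewrite -ak => /orP[]/(bdry_hom hm)->; rewrite ?orbT.
- by case: e => e; [case: (discrete_void dn e)|case: (discrete_void dn' e)].
have gL : glued (rf r) kC m i.
  split; split.
  - by move=> k; rewrite (kCV k : hmV i _ = _).
  - move=> v; case: (boolP [exists a, hmV m a == v]) => [/existsP[a /eqP<-]|/existsPn h].
      by left; exists a.
    by right; apply/iV/forallP => a; rewrite (negPf (h a)).
  - exact: mi.1.
  - move=> a y ay; have /iV/forallP/(_ a) : exists w, hmV i w = hmV m a by exists y.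
    rewrite eqxx /= => /orP[] /(lc_bdryL _ _ lc)[k [_ ka]]; exists k; split=> //;
      by apply: mi.1; rewrite -ay -ka; apply: kCV.
  - by move=> a a' /mV; left.
  - by move=> k; case: (lc_void lc k).
  - move=> e; case: (boolP [exists a, hmE m a == e]) => [/existsP[a /eqP<-]|/existsPn h].
      by left; exists a.
    by right; apply/iE/forallP => a; rewrite (negPf (h a)).
  - exact: mi.2.
  - move=> a y ay; have /iE/forallP/(_ a) : exists w, hmE i w = hmE m a by exists y.
    by rewrite eqxx.
  - by move=> a a' /mE; left.
(* The right-hand gluing takes [kC] as its injective leg, because [rg r] may fail to be mono. *)
have mkC : mono kC.
  split=> [k k' kk|k]; last by case: (lc_void lc k).
  by apply: (lc_mono lc).1; apply: mV; rewrite -[LHS]kCV -[RHS]kCV /= kk.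
have [H [c [d [wH hc hd gR]]]] := glue_exists hkC (lc_hom_rg lc) mkC wC (lc_wfR lc).
exists (@Deriv _ r n n' G nG n'G H (hcomp (hcomp (inj1 n n') nC) c)
  (hcomp (hcomp (inj2 n n') nC) c) m C i c kC d nC).
split=> //; split=> //; split; last first.
  do 2!split=> //; split=> //; split; first exact: (sc_convex hm maG (lc_sc lc)).
  do 2!split=> //; split; first by apply: glued_pushout => //; apply: lc_wf.
  split; first by apply: pushout_sym; apply: glued_pushout => //; apply: lc_wfR.
  by split=> //; split=> -[].
change (ma_cospan (hcomp (hcomp (inj1 n n') nC) c) (hcomp (hcomp (inj2 n n') nC) c)).
have cop k : hmV (copair (hcomp (hcomp (inj1 n n') nC) c) (hcomp (hcomp (inj2 n n') nC) c)) k
    = hmV c (hmV nC k) by case: k.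
have nCb b k : side b k -> bdry b (hmV i (hmV nC k)).
  by move=> s; apply/(cospan_bdry cG); exists k; rewrite (nCV k : hmV i _ = _).
apply: ma_cospan_intro => //; first exact: (step_ma lc maG hm hi hc hd gL gR).
  move=> b w; split=> [/(step_bdry lc maG hm hi hc hd gL gR mV)[v [/(cospan_bdry cG)[k [s kv]] <-]]|].
    by exists k; split=> //; rewrite cop; congr (hmV c _); apply: mi.1; rewrite -kv; apply: nCV.
  move=> [k [s <-]]; apply/(step_bdry lc maG hm hi hc hd gL gR mV).
  by exists (hmV nC k); rewrite cop nCb.
move=> b k k' s s'; rewrite !cop => kk; apply: (cospan_inj cG s s').
rewrite -[LHS]nCV -[RHS]nCV /=; congr (hmV i _).
exact: (step_bdry_inj lc hm gL gR (nCb _ _ s) (nCb _ _ s') kk).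
Qed.

(** * Parallel pairs *)

Lemma deriv_glued (r : rule Sg) n n' S (nS : hom n S) (n'S : hom n' S)
    (dd : deriv r nS n'S) : left_connected_rule r -> is_deriv dd ->
  glued (rf r) (dKC dd) (dmatch dd) (dCG dd).
Proof.
move=> lc [_ [_ [wC [_ [_ [_ [hk [_ [po _]]]]]]]]].
exact: pushout_glued (lc_hom_rf lc) hk (lc_mono lc) (lc_wf lc) wC po.
Qed.

(** The interface has no hyperedges, so a hyperedge of the match never comes from the complement as
    well. *)
Lemma common_edge_no_lift (r : rule Sg) n n' S L (nS : hom n S) (n'S : hom n' S)
    (dd : deriv r nS n'S) (m : hom L S) (g : hom L (dC dd)) e e' :
  left_connected_rule r -> is_deriv dd -> hmE m e = hmE (dmatch dd) e' ->
  ~ homeq (hcomp g (dCG dd)) m.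
Proof.
move=> lc h ee [_ gE]; have [_ [_ _ _ cd _]] := deriv_glued lc h.
have [k _] := cd e' (hmE g e) (etrans (esym ee) (esym (gE e))).
exact: lc_void lc k.
Qed.

Lemma disjoint_edges_lift (r : rule Sg) n n' S L (nS : hom n S) (n'S : hom n' S)
    (dd : deriv r nS n'S) (m : hom L S) :
  left_connected_rule r -> is_deriv dd -> is_hom m -> strongly_connected L ->
  (forall e e', hmE m e <> hmE (dmatch dd) e') ->
  exists g : hom L (dC dd), is_hom g /\ homeq (hcomp g (dCG dd)) m.
Proof.
move=> lc h hm sc ne.
have [[iV sV iVinj _ _] [_ sE iEinj _ _]] := deriv_glued lc h.
have [[_ [_ [_ [maS _]]]] [_ [_ [hm2 [_ [_ [_ [_ [po _]]]]]]]]] := h.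
have [_ [_ [hC _]]] := po.
apply: lift_mono => // [v|e]; last first.
  by case: (sE (hmE m e)) => // -[e' /esym/ne].
case: (sV (hmV m v)) => // -[w wv].
case: (boolP (bdry true w || bdry false w)) => [/orP[]/(lc_bdryL _ _ lc)[k [_ kw]]|].
- by exists (hmV (dKC dd) k); rewrite -iV kw.
- by exists (hmV (dKC dd) k); rewrite -iV kw.
rewrite negb_or => /andP[nt nf].
have nw b : ~~ bdry b w by case: b.
(* If [w] is interior to the other match, any hyperedge of [L] at [v] is forced into that match by
   monogamy; one exists because [v] is not isolated. *)
have [b /bdryPn[e [k ek]]] : exists b, ~~ bdry b v.
  case: (boolP (bdry true v)) => [vo|]; last by exists true.
  by exists false; apply/negP; apply: sc_not_isolated.
have ve : hmV m v \in inc b (hmE m e) by apply: mem_inc_hom => //; apply/onthP; exists k.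
rewrite -wv in ve; have [e0 e0e] := match_edge hm2 maS (nw b) ve.
by case: (ne e e0).
Qed.

(** * The induced hypergraph of an independent edge set *)

Lemma mem_zip_onth (U V : eqType) (s : seq U) (t : seq V) k x y :
  onth s k = Some x -> onth t k = Some y -> (x, y) \in zip s t.
Proof.
elim: s t k => [|a s ih] [|a' t] [|k] //=; first by case=> -> [->]; rewrite mem_head.
by move=> h1 h2; rewrite inE (ih _ _ h1 h2) orbT.
Qed.

Lemma gnodeP L1 L2 (M : {set hE L1 * hE L2}) p :
  reflect (exists b x, x \in M /\ p \in zip (inc b x.1) (inc b x.2)) (gnode M p).
Proof.
apply: (iffP existsP) => [[x /andP[xM /orP[px|px]]]|[b [x [xM px]]]].
- by exists true, x.
- by exists false, x.
- by exists x; rewrite xM; case: b px => /= ->; rewrite ?orbT.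
Qed.

Lemma inc_gamma L1 L2 (M : {set hE L1 * hE L2}) b (x : hE (gamma M)) :
  map val (inc b x) = zip (inc b (val x).1) (inc b (val x).2).
Proof.
have -> : inc b x = pmap insub (zip (inc b (val x).1) (inc b (val x).2)) by case: b.
rewrite (pmap_filter (insubK _)); apply/all_filterP/allP => p px.
by rewrite isSome_insub; apply/gnodeP; exists b, (val x); split=> //; apply: valP.
Qed.

(** Equal labels give equal arities, so [zip] truncates neither incidence list. *)
Lemma is_hom_gamma L1 L2 (M : {set hE L1 * hE L2}) : wf L1 -> wf L2 ->
  (forall x, x \in M -> hlab x.1 = hlab x.2) ->
  is_hom (gamma_p1 M) /\ is_hom (gamma_p2 M).
Proof.
move=> w1 w2 lab.
have sz b (x : hE (gamma M)) : size (inc b (val x).1) = size (inc b (val x).2).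
  by rewrite !wf_inc // lab //; apply: valP.
split; apply: is_hom_inc => [b x|x] //=.
- have -> : [seq (val p).1 | p <- inc b x] = unzip1 (map val (inc b x))
    by rewrite /unzip1 -map_comp.
  by rewrite inc_gamma unzip1_zip // sz.
- have -> : [seq (val p).2 | p <- inc b x] = unzip2 (map val (inc b x))
    by rewrite /unzip2 -map_comp.
  by rewrite inc_gamma unzip2_zip // sz.
- by rewrite lab //; apply: valP.
Qed.

Lemma edge_matching_functional L1 L2 (M : {set hE L1 * hE L2}) : edge_matching M ->
  (forall e e1 e2, (e, e1) \in M -> (e, e2) \in M -> e1 = e2) /\
  (forall e e1 e2, (e1, e) \in M -> (e2, e) \in M -> e1 = e2).
Proof.
move=> [_ ind]; split=> e e1 e2 h1 h2; apply/eqP; apply: contraT => ne.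
  have [|] := ind _ _ h1 h2; last by rewrite eqxx.
  by apply: contra ne => /eqP[->].
have [|_] := ind _ _ h1 h2; last by rewrite eqxx.
by apply: contra ne => /eqP[->].
Qed.

(** * Correctness *)

(** Testing against the bouquet on the hyperedges of [B]: when [A] has none, the identity on
    hyperedges is a valid cocone, and it factors through [q]. *)
Lemma coeq_edges_inj A B Q (f g : hom A B) (q : hom B Q) :
  wf B -> (hE A -> False) -> is_coeq f g q -> injective (hmE q).
Proof.
move=> wB nA [_ [_ [_ un]]].
have [||[u [_ [_ uE]]] _] := un _ (to_bouquet (@hlab _ B) id) (@wf_bouquet _ _).
- exact: is_hom_to_bouquet.
- by split=> // x; case: (nA x).
by move=> x y xy; rewrite -[x]uE -[y]uE /= xy.
Qed.

Lemma coeq_gamma_edges_inj L1 L2 (M : {set hE L1 * hE L2}) S (eps : hom (hsum L1 L2) S) :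
  wf L1 -> wf L2 -> edge_matching M ->
  is_coeq (hcomp (gamma_p1 M) (inj1 L1 L2)) (hcomp (gamma_p2 M) (inj2 L1 L2)) eps ->
  injective (fun e => hmE eps (inl e)) /\ injective (fun e => hmE eps (inr e)).
Proof.
move=> w1 w2 em [_ [_ [_ un]]]; have [fun1 fun2] := edge_matching_functional em.
(* Each hyperedge of [L2] is replaced by its partner in [M], if it has one. This coequalises the two
   projections and, by independence of [M], is injective on each summand. *)
pose f (e : hE (hsum L1 L2)) : hE (hsum L1 L2) := match e with
  | inl e => inl e
  | inr e' => if [pick e | (e, e') \in M] is Some e then inl e else inr e' end.
have [||[u [_ [_ uE]]] _] := un _ (to_bouquet (@hlab _ (hsum L1 L2)) f) (@wf_bouquet _ _).
- apply: is_hom_to_bouquet; first exact: wf_hsum.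
  by move=> [e|e] //=; case: pickP => //= e' /em.1.
- split=> // -[[e e'] eM] /=; case: pickP => [e1 /fun2|/(_ e)]; last by rewrite eM.
  by move=> /(_ _ eM)->.
have eqf x y : hmE eps x = hmE eps y -> f x = f y.
  by move=> xy; rewrite -[f x]uE -[f y]uE /= xy.
split=> x y /eqf; first by case.
move=> /=; case: pickP => [e1 h1|_]; case: pickP => [e2 h2|_] // [] // e12.
by subst e2; apply: fun1 h1 h2.
Qed.

Lemma alg_output_spec L1 L2 S' (q : hom (hsum L1 L2) S') :
  wf L1 -> wf L2 -> strongly_connected L1 -> strongly_connected L2 -> alg_output q ->
  [/\ is_hom q, epi q, mono (hcomp (inj1 L1 L2) q) /\ mono (hcomp (inj2 L1 L2) q),
      ma_cospan (hin_incl S') (hout_incl S') &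
      exists e e', hmE q (inl e) = hmE q (inr e')].
Proof.
move=> w1 w2 sc1 sc2 [M [em [M0 [S [eps [co [N [_ [eps' [co' [cS' [qV qE]]]]]]]]]]]].
have [wS [heps [[_ epsE] _]]] := co; have [_ [heps' _]] := co'.
have hq : is_hom q.
  by apply: is_hom_eq (is_hom_comp heps heps'); split=> x; rewrite ?qV ?qE.
(* The second quotient identifies nodes only, so each left-hand side still embeds on hyperedges. *)
have inj' : injective (hmE eps') by apply: coeq_edges_inj wS _ co' => -[].
have [inj_1 inj_2] := coeq_gamma_edges_inj w1 w2 em co.
have [_ [_ [_ [maS' _]]]] := cS'.
split=> //.
- have [sV sE] := coeq_epi co; have [sV' sE'] := coeq_epi co'.
  split=> y.
    by have [z <-] := sV' y; have [x <-] := sV z; exists x; rewrite qV.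
  by have [z <-] := sE' y; have [x <-] := sE z; exists x; rewrite qE.
- split; apply: mono_of_mono_edges => //; try exact: is_hom_comp.
    by move=> x y /=; rewrite !qE /= => /inj'/inj_1.
  by move=> x y /=; rewrite !qE /= => /inj'/inj_2.
- case/set0Pn: M0 => x xM; exists x.1, x.2; rewrite !qE /=; congr (hmE eps' _).
  exact: (epsE (Sub x xM)).
Qed.

(** * Exhaustiveness *)

Section Exhaustive.
Variables (L1 L2 X : hyp Sg) (e : hom (hsum L1 L2) X).
Let m1 := hcomp (inj1 L1 L2) e.
Let m2 := hcomp (inj2 L1 L2) e.
Hypotheses (w1 : wf L1) (w2 : wf L2).
Hypotheses (sc1 : strongly_connected L1) (sc2 : strongly_connected L2).
Hypotheses (he : is_hom e) (ee : epi e) (mm1 : mono m1) (mm2 : mono m2).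
Hypothesis cX : ma_cospan (hin_incl X) (hout_incl X).

Let maX : ma X. Proof. by case: cX => _ [_ [_ []]]. Qed.
Let wX : wf X. Proof. by case: cX => _ [_ []]. Qed.
Let hm1 : is_hom m1. Proof. exact: is_hom_comp. Qed.
Let hm2 : is_hom m2. Proof. exact: is_hom_comp. Qed.

Definition overlap : {set hE L1 * hE L2} := [set x | hmE m1 x.1 == hmE m2 x.2].

Lemma overlapP x y : reflect (hmE m1 x = hmE m2 y) ((x, y) \in overlap).
Proof. by rewrite inE; apply: eqP. Qed.

Lemma overlap_matching : edge_matching overlap.
Proof.
split=> [[x y] /overlapP xy|[x y] [x' y'] /overlapP xy /overlapP xy' ne] /=.
  by rewrite -(lab_hom x hm1) xy lab_hom.
split; apply: contra ne => /eqP; [move=> xx|move=> yy]; apply/eqP; congr pair => //.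
  by apply: mm2.2; rewrite -xy -xy' xx.
by apply: mm1.2; rewrite xy xy' yy.
Qed.

Lemma overlap_node p : gnode overlap p -> hmV m1 p.1 = hmV m2 p.2.
Proof.
case/gnodeP=> b [[x y] [/overlapP xy]] /=.
have : map (hmV m1) (inc b x) = map (hmV m2) (inc b y) by rewrite -!inc_hom // xy.
elim: (inc b x) (inc b y) => [|v s ih] [|w t] //= [vw st]; rewrite inE => /predU1P[->//|].
exact: ih.
Qed.

(** This projection serves as the injective leg when [L2] and [L1] are glued along [gamma overlap],
    which is why [L2] comes first in the gluing below. *)
Let mono_p2 : mono (gamma_p2 overlap).
Proof.
split=> [[[v w] vw] [[v' w'] vw']|[[x y] xy] [[x' y'] xy']] /= e0; subst; apply: val_inj => /=.
  have h := overlap_node vw; have h' := overlap_node vw'.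
  by congr pair; apply: mm1.1; rewrite [LHS]h [RHS]h'.
by congr pair; apply: mm1.2; move/overlapP: xy => ->; move/overlapP: xy' => ->.
Qed.

Section Quotient.
Variables (S : hyp Sg) (c : hom L2 S) (d : hom L1 S).
Hypotheses (wS : wf S) (hc : is_hom c) (hd : is_hom d).
Hypothesis g : glued (gamma_p2 overlap) (gamma_p1 overlap) c d.

Let epi_cd : epi (copair d c).
Proof.
have [sV sE] := glued_epi g.
by split=> y; [have [[x|x] <-] := sV y|have [[x|x] <-] := sE y];
  by [exists (inr x)|exists (inl x)].
Qed.

(** A pushout of the two projections is a coequaliser on the coproduct. *)
Lemma overlap_coeq : is_coeq (hcomp (gamma_p1 overlap) (inj1 L1 L2))
  (hcomp (gamma_p2 overlap) (inj2 L1 L2)) (copair d c).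
Proof.
have [[eV _ _ _ _] [eE _ _ _ _]] := g.
apply: is_coeq_intro => //; first exact: is_hom_copair.
  by split=> x /=; rewrite ?eV ?eE.
move=> T x hx [xV xE].
have [V1 V2 V3] := glued_fun_kernel (x := fun v => hmV x (inr v)) (y := fun v => hmV x (inl v))
  g.1 (fun k => esym (xV k)).
have [E1 E2 E3] := glued_fun_kernel (x := fun v => hmE x (inr v)) (y := fun v => hmE x (inl v))
  g.2 (fun k => esym (xE k)).
split=> -[v|v] [v'|v'] /=; try (by [apply: V1|apply: V2|apply: V3|apply: E1|apply: E2|apply: E3]).
  by move/esym/V2.
by move/esym/E2.
Qed.

Variable u : hom S X.
Hypotheses (hu : is_hom u) (ue : homeq (hcomp (copair d c) u) e).

Let ud v : hmV u (hmV d v) = hmV m1 v. Proof. exact: (ue.1 (inl v)). Qed.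
Let uc v : hmV u (hmV c v) = hmV m2 v. Proof. exact: (ue.1 (inr v)). Qed.
Let udE x : hmE u (hmE d x) = hmE m1 x. Proof. exact: (ue.2 (inl x)). Qed.
Let ucE x : hmE u (hmE c x) = hmE m2 x. Proof. exact: (ue.2 (inr x)). Qed.

(** Hyperedges with a common image in [X] were already merged in [S] through [overlap]; only nodes
    remain to be identified. *)
Let uE_inj : injective (hmE u).
Proof.
have [eE sE _ _ _] := g.2.
have cd x y : hmE m1 x = hmE m2 y -> hmE d x = hmE c y.
  by move/overlapP => xy; rewrite -[LHS](eE (Sub (x, y) xy)).
move=> a a'; case: (sE a) => [[x <-]|[x <-]]; case: (sE a') => [[y <-]|[y <-]].
- by rewrite !ucE => /mm2.2->.
- by rewrite ucE udE => /esym/cd.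
- by rewrite ucE udE => /cd.
- by rewrite !udE => /mm1.2->.
Qed.

(* The pairs of nodes that still have to be identified. *)
Definition residual v w := (hmV m1 v == hmV m2 w) && (hmV d v != hmV c w).

(** If both nodes had a hyperedge on side [b], monogamy of [X] would place them at the same position
    of a shared hyperedge, so [(v, w)] would be a node of [gamma overlap] and already glued. *)
Lemma residual_bdry b v w : residual v w -> bdry b v || bdry b w.
Proof.
move=> /andP[/eqP vw]; apply: contraR; rewrite negb_or.
move=> /andP[/bdryPn[x [k xk]] /bdryPn[y [k' yk]]]; apply/eqP.
have yk2 := onth_inc_hom hm2 yk; rewrite -vw in yk2.
have [xy kk] := (deg_le1P b _).1 (ma_deg b _ maX) _ _ _ _ (onth_inc_hom hm1 xk) yk2.
subst k'; have gn : gnode overlap (v, w).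
  by apply/gnodeP; exists b, (x, y); split; [apply/overlapP|apply: mem_zip_onth xk yk].
have [eV _ _ _ _] := g.1.
by rewrite -[LHS](eV (Sub (v, w) gn)).
Qed.

(** The procedure asks for inputs and outputs of [S], not only of [L1]. A hyperedge of [S] at [d v]
    coming from [L2] would mean that [v] is already glued to a node of [L2], which can only be [w]
    since [m2] is injective. *)
Lemma residual_bdryd b v w : residual v w -> bdry b v -> bdry b (hmV d v).
Proof.
have [_ sE _ _ _] := g.2; have [_ _ dV_inj _ _] := g.1.
move=> /andP[/eqP vw ne] bv; apply/bdryP => h; apply/negP.
case: (sE h) => [[x <-]|[x <-]].
  move=> /(mem_hom_inv hc)[w' _ w'v]; move: (uc w'); rewrite w'v ud vw => /mm2.1 ww.
  by rewrite -w'v -ww eqxx in ne.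
move=> /(mem_hom_inv hd)[v' v'x /dV_inj vv]; subst v'.
by move/bdryP: bv => /(_ x); rewrite v'x.
Qed.

Lemma residual_bdryc b v w : residual v w -> bdry b w -> bdry b (hmV c w).
Proof.
have [_ sE _ _ _] := g.2.
move=> /andP[/eqP vw ne] bw; apply/bdryP => h; apply/negP.
case: (sE h) => [[x <-]|[x <-]].
  move=> /(mem_hom_inv hc)[w' w'x w'w]; move: (uc w'); rewrite w'w uc => /mm2.1 ww.
  by subst w'; move/bdryP: bw => /(_ x); rewrite w'x.
move=> /(mem_hom_inv hd)[v' _ v'w]; move: (ud v'); rewrite v'w uc -vw => /mm1.1 vv.
by rewrite -v'w -vv eqxx in ne.
Qed.

(* All residual pairs point the same way: two pairs of opposite directions
   would close a cycle through both strongly connected left-hand sides. *)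
Lemma residual_side : exists b, forall v w, residual v w -> bdry b v /\ bdry (~~ b) w.
Proof.
have dich v w : residual v w ->
    (bdry true v /\ bdry false w) \/ (bdry false v /\ bdry true w).
  move=> rvw; case/orP: (residual_bdry true rvw); case/orP: (residual_bdry false rvw).
  - by move=> vi vo; case: (sc_not_isolated sc1 vo vi).
  - by left.
  - by right.
  - by move=> wi wo; case: (sc_not_isolated sc2 wo wi).
case: (boolP [exists v, exists w, residual v w && bdry false v]).
  move=> /existsP[v /existsP[w /andP[rvw vi]]].
  have wo : bdry true w by case: (dich v w rvw) => -[// vo]; case: (sc_not_isolated sc1 vo vi).
  exists false => v' w' rvw'; case: (dich _ _ rvw') => // -[v'o w'i].
  (* The path from [w'] to [w] in [L2] becomes a path in [X] from the output [v'] of [L1] back to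
     its input [v]. *)
  have /path_from_toP[e1 [e2 [e12 w'e1 we2]]] := sc2 w'i wo.
  case: (sc_no_return hm1 maX sc1 vi v'o _ _ (connect_hom hm2 e12)).
    by case/andP: rvw' => /eqP-> _; apply: mem_inc_hom.
  by case/andP: rvw => /eqP-> _; apply: mem_inc_hom.
move=> /existsPn h; exists true => v w rvw; case: (dich _ _ rvw) => // -[vi _].
by have /existsPn/(_ w) := h v; rewrite rvw vi.
Qed.

(** The pairs may be listed in either order, so that both orientations of [N] in the procedure are
    covered. *)
Lemma residual_coeq (N : {set hV S * hV S}) :
  (forall p, p \in N -> hmV u p.1 = hmV u p.2) ->
  (forall v w, residual v w -> (hmV d v, hmV c w) \in N \/ (hmV c w, hmV d v) \in N) ->
  is_coeq (dproj1 N id) (dproj2 N id) u.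
Proof.
move=> uN rN; have [_ sV _ _ _] := g.1.
apply: is_coeq_intro => //.
- split=> y; have [sV' sE'] := ee.
    by have [x <-] := sV' y; exists (hmV (copair d c) x); rewrite -[RHS]ue.1.
  by have [x <-] := sE' y; exists (hmE (copair d c) x); rewrite -[RHS]ue.2.
- by split=> [p|[]] /=; apply: uN; apply: valP.
move=> T x hx [xV _]; split; last by move=> y y' /uE_inj->.
have xN p (pN : p \in N) : hmV x p.1 = hmV x p.2 := xV (exist (fun q => q \in N) p pN).
have cd v w : hmV m1 v = hmV m2 w -> hmV x (hmV d v) = hmV x (hmV c w).
  move=> vw; case: (eqVneq (hmV d v) (hmV c w)) => [->//|ne].
  have [|vN|vN] := rN v w; first by rewrite /residual vw eqxx.
    exact: (xN _ vN).
  exact: esym (xN _ vN).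
move=> a a'; case: (sV a) => [[v <-]|[v <-]]; case: (sV a') => [[w <-]|[w <-]].
- by rewrite !uc => /mm2.1->.
- by rewrite uc ud => /esym/cd.
- by rewrite uc ud => /cd.
- by rewrite !ud => /mm1.1->.
Qed.

Definition residual_pairs : {set hV S * hV S} :=
  [set p | [exists v, exists w, residual v w && (p == (hmV d v, hmV c w))]].

Lemma residual_pairsP p :
  reflect (exists v w, residual v w /\ p = (hmV d v, hmV c w)) (p \in residual_pairs).
Proof.
rewrite inE; apply: (iffP existsP) => [[v /existsP[w /andP[r /eqP->]]]|[v [w [r ->]]]].
  by exists v, w.
by exists v; apply/existsP; exists w; rewrite r eqxx.
Qed.

Lemma residual_pairs_indep p p' : p \in residual_pairs -> p' \in residual_pairs -> p != p' ->
  p.1 != p'.1 /\ p.2 != p'.2.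
Proof.
move=> /residual_pairsP[v [w [/andP[/eqP vw _] ->]]].
move=> /residual_pairsP[v' [w' [/andP[/eqP vw' _] ->]]] /= ne.
split; apply: contra ne => /eqP q; rewrite q.
  move: (ud v); rewrite q ud vw vw' => /mm2.1->; exact: eqxx.
move: (uc w); rewrite q uc -vw -vw' => /mm1.1->; exact: eqxx.
Qed.

Lemma overlap_output : overlap != set0 -> alg_output e.
Proof.
move=> M0; exists overlap; split; first exact: overlap_matching.
split=> //; exists S, (copair d c); split; first exact: overlap_coeq.
have uN p : p \in residual_pairs -> hmV u p.1 = hmV u p.2.
  by case/residual_pairsP=> v [w [/andP[/eqP vw _] ->]] /=; rewrite ud uc.
have [b bP] := residual_side; move=> I1 I2 O1 O2.
have bd v w : residual v w -> bdry b (hmV d v) && bdry (~~ b) (hmV c w).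
  by move=> r; have [bv bw] := bP v w r; rewrite (residual_bdryd r bv) (residual_bdryc r bw).
case: b bP bd => bP bd.
  (* Outputs of [L1] meet inputs of [L2]: the pairs are flipped to form an independent edge set
     between [I2] and [O1]. The other case needs no flip. *)
  exists [set p | (p.2, p.1) \in residual_pairs]; split.
    right; split=> [[p1 p2]|[p1 p2] [p1' p2']].
      rewrite in_set => /residual_pairsP[v [w [r [-> ->]]]].
      have [vo wi] := bP v w r; have /andP[dvo cwi] := bd v w r.
      split; apply/andP; split=> //; apply/existsP; [exists w|exists v]; apply/andP; split=> //.
    rewrite in_set => /residual_pairs_indep h; rewrite in_set => /h{}h ne.
    by case: h => //; apply: contra ne => /eqP[-> ->].
  exists u; split; last by split=> //; apply: homeq_sym.
  apply: residual_coeq => [[p1 p2]|v w r]; first by rewrite in_set => /uN.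
  by right; rewrite in_set; apply/residual_pairsP; exists v, w.
exists residual_pairs; split.
  left; split; last exact: residual_pairs_indep.
  move=> p /residual_pairsP[v [w [r ->]]].
  have [vi wo] := bP v w r; have /andP[dvi cwo] := bd v w r.
  by split; apply/andP; split=> //; apply/existsP; [exists v|exists w]; apply/andP; split=> //.
exists u; split; last by split=> //; apply: homeq_sym.
apply: residual_coeq => [//|v w r].
by left; apply/residual_pairsP; exists v, w.
Qed.

End Quotient.

Lemma overlapping_output : overlap != set0 -> alg_output e.
Proof.
have [hp1 hp2] := is_hom_gamma w1 w2 overlap_matching.1.
have [S [c [d [wS hc hd g]]]] := glue_exists hp2 hp1 mono_p2 w2 w1.
have [_ [_ [_ un]]] := overlap_coeq wS hc hd g.
have [|[u [hu ue]] _] := un X e wX he.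
  split=> [x|x] /=; first exact: (overlap_node (valP x)).
  by have := valP x; rewrite inE => /eqP.
exact: overlap_output ue.
Qed.

End Exhaustive.

Lemma critical_overlap (r1 r2 : rule Sg) n n' X (nX : hom n X) (n'X : hom n' X)
    (e : hom (hsum (rL r1) (rL r2)) X) (d1 : deriv r1 nX n'X) (d2 : deriv r2 nX n'X) :
  left_connected_rule r1 -> left_connected_rule r2 ->
  homeq (dmatch d1) (hcomp (inj1 (rL r1) (rL r2)) e) ->
  homeq (dmatch d2) (hcomp (inj2 (rL r1) (rL r2)) e) ->
  critical d1 d2 -> overlap e != set0.
Proof.
move=> lc1 lc2 [_ e1] [_ e2] [[h1 [h2 _]] np]; apply/negP => /eqP M0; apply: np.
have ne x y : hmE (dmatch d1) x <> hmE (dmatch d2) y.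
  by rewrite e1 e2 => /overlapP; rewrite M0 inE.
have hm1 : is_hom (dmatch d1) by case: h1 => _ [_ [_ []]].
have hm2 : is_hom (dmatch d2) by case: h2 => _ [_ [_ []]].
have [g1 [hg1 g1e]] := disjoint_edges_lift lc2 h2 hm1 (lc_sc lc1) ne.
have [|g2 [hg2 g2e]] := disjoint_edges_lift lc1 h1 hm2 (lc_sc lc2).
  by move=> x y /esym/ne.
by exists g1, g2.
Qed.

End Hypergraphs.

Theorem mainTheorem7 (Sg : signature) (Idx : finType) (Rs : Idx -> rule Sg)
  (HR : forall i, left_connected_rule (Rs i)) :
  (* Correctness *)
  (forall (i j : Idx) (S' : hyp Sg) (q : hom (hsum (rL (Rs i)) (rL (Rs j))) S'),
     alg_output q ->
     mono (hcomp (inj1 (rL (Rs i)) (rL (Rs j))) q) /\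
     mono (hcomp (inj2 (rL (Rs i)) (rL (Rs j))) q) /\
     epi q /\
     ma_cospan (hin_incl S') (hout_incl S') /\
     (exists (d1 : deriv (Rs i) (hin_incl S') (hout_incl S'))
             (d2 : deriv (Rs j) (hin_incl S') (hout_incl S')),
        is_deriv d1 /\ is_deriv d2 /\
        homeq (dmatch d1) (hcomp (inj1 (rL (Rs i)) (rL (Rs j))) q) /\
        homeq (dmatch d2) (hcomp (inj2 (rL (Rs i)) (rL (Rs j))) q)) /\
     (forall (d1 : deriv (Rs i) (hin_incl S') (hout_incl S'))
             (d2 : deriv (Rs j) (hin_incl S') (hout_incl S')),
        is_deriv d1 -> is_deriv d2 ->
        homeq (dmatch d1) (hcomp (inj1 (rL (Rs i)) (rL (Rs j))) q) ->
        homeq (dmatch d2) (hcomp (inj2 (rL (Rs i)) (rL (Rs j))) q) ->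
        critical d1 d2)) /\
  (* Exhaustiveness *)
  (forall (i j : Idx) (X : hyp Sg) (e : hom (hsum (rL (Rs i)) (rL (Rs j))) X),
     wf X -> is_hom e -> epi e ->
     ma_cospan (hin_incl X) (hout_incl X) ->
     (exists (d1 : deriv (Rs i) (hin_incl X) (hout_incl X))
             (d2 : deriv (Rs j) (hin_incl X) (hout_incl X)),
        homeq (dmatch d1) (hcomp (inj1 (rL (Rs i)) (rL (Rs j))) e) /\
        homeq (dmatch d2) (hcomp (inj2 (rL (Rs i)) (rL (Rs j))) e) /\
        critical d1 d2) ->
     exists (S' : hyp Sg) (q : hom (hsum (rL (Rs i)) (rL (Rs j))) S'),
       alg_output q /\
       exists phi : hom S' X,
         iso phi /\ homeq (hcomp q phi) e /\
         (forall v : hV S', inP v = inP (hmV phi v)) /\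
         (forall v : hV S', outP v = outP (hmV phi v))).
Proof.
split=> [i j S' q out|i j X e wX he ee cX [d1 [d2 [m1 [m2 cr]]]]].
  have [hq eq [mq1 mq2] cS' [x [y xy]]] :=
    alg_output_spec (lc_wf (HR i)) (lc_wf (HR j)) (lc_sc (HR i)) (lc_sc (HR j)) out.
  do 4!split=> //; split.
    have [d1 [h1 e1]] := deriv_exists (HR i) cS' (is_hom_comp (@is_hom_inj1 _ _ _) hq) mq1.
    have [d2 [h2 e2]] := deriv_exists (HR j) cS' (is_hom_comp (@is_hom_inj2 _ _ _) hq) mq2.
    by exists d1, d2; rewrite e1 e2.
  move=> d1 d2 h1 h2 [V1 E1] [V2 E2]; split.
    split=> //; split=> //; have [eV eE] := eq.
    split=> z; [have [w <-] := eV z|have [w <-] := eE z]; exists w; case: w => w /=;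
      by rewrite ?V1 ?V2 ?E1 ?E2.
  (* The lift [g1] of the first match would carry the shared hyperedge into the complement of the
     second. *)
  move=> [g1 [_ [_ [_ [ge _]]]]].
  have xy' : hmE (dmatch d1) x = hmE (dmatch d2) y by rewrite E1 E2.
  exact: (common_edge_no_lift (HR j) h2 xy' ge).
have M0 := critical_overlap (HR i) (HR j) m1 m2 cr.
have [[[_ [_ [_ [_ [mm1 _]]]]] [[_ [_ [_ [_ [mm2 _]]]]] _]] _] := cr.
(* The procedure admits any choice of coequalisers, so [X] itself is an output and the isomorphism
   is the identity. *)
exists X, e; split.
  by apply: overlapping_output (lc_wf (HR i)) (lc_wf (HR j)) (lc_sc (HR i)) (lc_sc (HR j)) he ee
    (mono_eq m1 mm1) (mono_eq m2 mm2) cX M0.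
exists (Hom id id); split=> //; split; last by split; exists id.
by move=> x /=; rewrite !map_id.
Qed.
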